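(* Let $f\in\mathcal{S}'(\mathbb{R}^n)$, let $\alpha\in\mathbb{R}$, and let $\rho(t)$, $t>0$, be an automodel function of degree $\alpha$. Then $f$ has a quasi-asymptotics of degree $\alpha$ at infinity with respect to $\rho(t)$ if and only if its Fourier transform $F[f]$ has a quasi-asymptotics of degree $-\alpha-n$ at zero with respect to the automodel function $t^n\rho(t)$.
   Context: $\mathcal{S}(\mathbb{R}^n)$ is the Schwartz space and $\mathcal{S}'(\mathbb{R}^n)$ its dual, with (weak) convergence tested on each element of $\mathcal{S}(\mathbb{R}^n)$. Fourier transform: for $\varphi\in\mathcal{S}(\mathbb{R}^n)$, $F[\varphi](\xi)=\int_{\mathbb{R}^n}e^{i\xi\cdot x}\varphi(x)\,d^nx$; for $f\in\mathcal{S}'(\mathbb{R}^n)$, $\langle F[f],\varphi\rangle=\langle f,F[\varphi]\rangle$. Dilation: for $s>0$, $\langle f(sx),\varphi(x)\rangle=s^{-n}\langle f(x),\varphi(x/s)\rangle$; $f(x/t)$ is the case $s=1/t$. Automodel (regularly varying) function of degree $\alpha\in\mathbb{R}$: a positive continuous real-valued function $\rho$ on $(0,\infty)$ such that for every $a>0$, $\lim_{t\to\infty}\rho(ta)/\rho(t)=a^{\alpha}$. Quasi-asymptotics at infinity: $f\in\mathcal{S}'(\mathbb{R}^n)$ has the quasi-asymptotics $g$ of degree $\alpha$ at infinity with respect to an automodel function $\rho$ of degree $\alpha$ if $f(tx)/\rho(t)\to g(x)$ in $\mathcal{S}'(\mathbb{R}^n)$ as $t\to\infty$, with $g\not\equiv0$.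 Quasi-asymptotics at zero: $f\in\mathcal{S}'(\mathbb{R}^n)$ has the quasi-asymptotics $g$ of degree $-\alpha$ at zero with respect to an automodel function $\rho$ of degree $\alpha$ if $f(x/t)/\rho(t)\to g(x)$ in $\mathcal{S}'(\mathbb{R}^n)$ as $t\to\infty$, with $g\not\equiv0$. *)

(* Defs.v *)
From HB Require Import structures.
From mathcomp Require Import all_boot all_order all_algebra.
From mathcomp Require Import all_classical all_reals all_analysis.
From mathcomp Require Import complex.

Set Implicit Arguments.
Unset Strict Implicit.
Unset Printing Implicit Defensive.

Import Order.TTheory GRing.Theory Num.Theory.
Import numFieldNormedType.Exports.

Local Open Scope classical_set_scope.
Local Open Scope ring_scope.
Local Open Scope complex_scope.

(* A point of R^n is a row vector 'rV[R]_n, which carries the normed-space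
   structure used for partial derivatives.  The library puts the product
   sigma-algebra on n.-tuple R rather than on row vectors, so Lebesgue measure
   is built there, and integrands are composed with [row_of_tuple]. *)

Section LebesgueMeasure.
Variable R : realType.

Definition row_of_tuple n (t : n.-tuple R) : 'rV[R]_n := \row_i tnth t i.

Definition tuple_cons n (p : R * n.-tuple R) : n.+1.-tuple R :=
  [tuple of p.1 :: p.2].

Definition tuple_uncons n (t : n.+1.-tuple R) : R * n.-tuple R :=
  (thead t, [tuple of behead t]).

Lemma tuple_consK n : cancel (@tuple_cons n) (@tuple_uncons n).
Proof. by case=> x t; congr pair; apply: val_inj. Qed.

Lemma measurable_tuple_cons n :
  measurable_fun [set: R * n.-tuple R] (@tuple_cons n).
Proof. exact: (measurable_cons measurable_fst measurable_snd). Qed.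

Lemma measurable_tuple_uncons n :
  measurable_fun [set: n.+1.-tuple R] (@tuple_uncons n).
Proof.
apply: measurable_fun_pair; first exact: measurable_tnth.
exact: measurable_behead.
Qed.

Section Cons.
Variables (n : nat) (mu : {sigma_finite_measure set (n.-tuple R) -> \bar R}).

Definition cons_measure : set (n.+1.-tuple R) -> \bar R :=
  pushforward (@lebesgue_measure R \x mu)%E (@tuple_cons n).

Let cons_measure0 : cons_measure set0 = 0%E.
Proof. by rewrite /cons_measure /pushforward preimage_set0 measure0. Qed.

Let cons_measure_ge0 A : (0 <= cons_measure A)%E.
Proof. by rewrite /cons_measure /pushforward; exact: measure_ge0. Qed.

Let cons_measure_sigma_additive : semi_sigma_additive cons_measure.
Proof.
move=> F mF tF mUF; rewrite /cons_measure /pushforward preimage_bigcup.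
have mp A : measurable A -> measurable (@tuple_cons n @^-1` A).
  by move=> mA; rewrite -[X in measurable X]setTI; exact: measurable_tuple_cons.
apply: measure_semi_sigma_additive; first by move=> k; exact: mp.
- apply/trivIsetP => /= i j _ _ ij; rewrite -preimage_setI.
  by move/trivIsetP : tF => /(_ _ _ _ _ ij) ->//; rewrite preimage_set0.
- by rewrite -preimage_bigcup; exact: mp.
Qed.

HB.instance Definition _ := isMeasure.Build _ _ _ cons_measure
  cons_measure0 cons_measure_ge0 cons_measure_sigma_additive.

Let cons_measure_sigma_finite : sigma_finite setT cons_measure.
Proof.
have mu12 A B : measurable A -> measurable B ->
    cons_measure (@tuple_uncons n @^-1` (A `*` B)) =
    (@lebesgue_measure R A * mu B)%E.
  move=> mA mB; rewrite -product_measure1E//.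
  rewrite /cons_measure /pushforward -comp_preimage.
  by rewrite (_ : _ \o _ = id)//; apply/funext; exact: tuple_consK.
have /sigma_finiteP[F [TF ndF Foo]] := sigma_finiteT (@lebesgue_measure R).
have /sigma_finiteP[G [TG ndG Goo]] := sigma_finiteT mu.
exists (fun k => @tuple_uncons n @^-1` (F k `*` G k)).
  rewrite -preimage_bigcup (_ : \bigcup_k _ = setT) ?preimage_setT//.
  apply/seteqP; split => // -[x y] _.
  have [k _ Fx] : (\bigcup_k F k) x by rewrite -TF.
  have [l _ Gy] : (\bigcup_k G k) y by rewrite -TG.
  exists (maxn k l) => //; split => /=.
    by move: x Fx; exact/subsetPset/ndF/leq_maxl.
  by move: y Gy; exact/subsetPset/ndG/leq_maxr.
move=> k; have [mF Fk] := Foo k; have [mG Gk] := Goo k; split.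
  rewrite -[X in measurable X]setTI.
  by apply: measurable_tuple_uncons => //; exact: measurableX.
by rewrite mu12// lte_mul_pinfty// ge0_fin_numE.
Qed.

HB.instance Definition _ := Measure_isSigmaFinite.Build _ _ _ cons_measure
  cons_measure_sigma_finite.

End Cons.

(* Lebesgue measure on R^n, as the n-fold product of the one on R. *)
Fixpoint lebesgue_measure_tuple n :
    {sigma_finite_measure set (n.-tuple R) -> \bar R} :=
  if n is n'.+1 return {sigma_finite_measure set (n.-tuple R) -> \bar R}
  then cons_measure (lebesgue_measure_tuple n')
  else dirac [tuple].

End LebesgueMeasure.

Section TemperedDistributions.
Variables (R : realType) (n : nat).
Local Notation Rn := 'rV[R]_n.
Local Notation C := R[i].

(* C is a normed space over itself only under the alias C^o. *)

(* Integral over R^n of an integrable complex-valued function. *)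
Definition integralRn (h : Rn -> C) : C :=
  Rintegral (lebesgue_measure_tuple R n) setT
    (fun t => complex.Re (h (row_of_tuple t)))
  +i* Rintegral (lebesgue_measure_tuple R n) setT
    (fun t => complex.Im (h (row_of_tuple t))).

Definition dotp (x y : Rn) : R := \sum_i x 0 i * y 0 i.

Definition expi (theta : R) : C := cos theta +i* sin theta.

Definition fourier (phi : Rn -> C) (xi : Rn) : C :=
  integralRn (fun x => expi (dotp xi x) * phi x).

Definition partial (i : 'I_n) (phi : Rn -> C) (x : Rn) : C :=
  'D_(delta_mx 0 i) (fun y => complex.Re (phi y)) x
  +i* 'D_(delta_mx 0 i) (fun y => complex.Im (phi y)) x.

(* Iterated partial derivatives along a list of coordinates: the derivative
   of multi-index beta is the one along any list in which each i occurs
   (beta i) times. *)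
Definition partials (s : seq 'I_n) (phi : Rn -> C) : Rn -> C :=
  foldr partial phi s.

Definition smooth (phi : Rn -> C) : Prop :=
  forall s : seq 'I_n,
    continuous (partials s phi : Rn -> C^o) /\
    forall (i : 'I_n) (x : Rn),
      derivable (fun y => complex.Re (partials s phi y)) x (delta_mx 0 i) /\
      derivable (fun y => complex.Im (partials s phi y)) x (delta_mx 0 i).

Definition monomial (a : {ffun 'I_n -> nat}) (x : Rn) : R :=
  \prod_i x 0 i ^+ a i.

(* sup_x |x^a D^s phi(x)| *)
Definition seminorm (a : {ffun 'I_n -> nat}) (s : seq 'I_n) (phi : Rn -> C) :
    \bar R :=
  ereal_sup [set (`|monomial a x| * Normc.normc (partials s phi x))%:E
            | x in [set: Rn]].

Definition schwartz (phi : Rn -> C) : Prop :=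
  smooth phi /\ forall a s, (seminorm a s phi < +oo)%E.

(* A distribution is represented by a functional defined on all functions
   R^n -> C; only its values on Schwartz functions are meaningful, and every
   notion below refers to these values only. *)
Definition functional := (Rn -> C) -> C.

Definition linear_on_schwartz (f : functional) : Prop :=
  forall (c : C) (phi psi : Rn -> C), schwartz phi -> schwartz psi ->
    f (fun x => c * phi x + psi x) = c * f phi + f psi.

(* Continuity for the locally convex topology defined by the seminorms. *)
Definition continuous_on_schwartz (f : functional) : Prop :=
  forall phi, schwartz phi -> forall e : R, 0 < e ->
    exists (l : seq ({ffun 'I_n -> nat} * seq 'I_n)) (d : R), 0 < d /\
      forall psi, schwartz psi ->
        (forall p, p \in l ->
           (seminorm p.1 p.2 (fun x => psi x - phi x)%R < d%:E)%E) ->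
        Normc.normc (f psi - f phi) < e.

Definition tempered (f : functional) : Prop :=
  linear_on_schwartz f /\ continuous_on_schwartz f.

Definition nonzero (g : functional) : Prop :=
  exists phi, schwartz phi /\ g phi <> 0.

Definition distr_fourier (f : functional) : functional :=
  fun phi => f (fourier phi).

(* The distribution f(s x). *)
Definition dilate (s : R) (f : functional) : functional :=
  fun phi => (s ^- n)%:C * f (fun x => phi (s^-1 *: x)).

(* u t --> g in S'(R^n) as t --> +oo *)
Definition weak_cvg (u : R -> functional) (g : functional) : Prop :=
  forall phi, schwartz phi ->
    (u t phi : C^o) @[t --> +oo] --> (g phi : C^o).

Definition automodel (alpha : R) (rho : R -> R) : Prop :=
  [/\ forall t, 0 < t -> 0 < rho t,
      {in `]0, +oo[, continuous rho} &
      forall a, 0 < a -> rho (t * a) / rho t @[t --> +oo] --> a `^ alpha].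

Definition quasi_asymptotics_infty (alpha : R) (rho : R -> R)
    (f g : functional) : Prop :=
  [/\ automodel alpha rho, tempered f, tempered g, nonzero g &
      weak_cvg (fun t phi => ((rho t)^-1)%:C * dilate t f phi) g].

(* The degree of a quasi-asymptotics at zero is the opposite of the degree
   of the automodel function. *)
Definition quasi_asymptotics_zero (beta : R) (rho : R -> R)
    (f g : functional) : Prop :=
  [/\ automodel (- beta) rho, tempered f, tempered g, nonzero g &
      weak_cvg (fun t phi => ((rho t)^-1)%:C * dilate t^-1 f phi) g].

End TemperedDistributions.

(* Main.v *)
Require Import Defs.
From mathcomp Require Import all_boot all_order all_algebra.
From mathcomp Require Import all_classical all_reals all_analysis.
From mathcomp Require Import complex measurable_realfun lra ring.
Import Order.TTheory GRing.Theory Num.Theory.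
Import numFieldNormedType.Exports.
Set Implicit Arguments.
Unset Strict Implicit.
Unset Printing Implicit Defensive.
Local Open Scope classical_set_scope.
Local Open Scope ring_scope.
Local Open Scope complex_scope.

(** The theorem is formal once three facts are known: the Fourier transform
[fourier] maps the Schwartz space to itself continuously, it is bijective
there, and it exchanges the dilations by [t] and [1/t]. The last one gives
[F[f](x/t) / (t^n rho t)] tested on [phi] equal to [f(tx) / rho t] tested on
[fourier phi] ([dilate_distr_fourier]); hence the two families converge
together, the limits being related by [g |-> F[g]], and bijectivity
transfers the condition that the limit is nonzero.

Continuity ([cont_op_fourier]) follows from the exchange of differentiation
and multiplication by a coordinate. The partial derivatives of [fourier phi]
come from a second-order Taylor bound on the plane wave, and the exchange in
the other direction from [integralRn_partial], itself a consequence of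
translation invariance. To avoid computing iterated derivatives, membership
in the Schwartz space and seminorm bounds are proved together by coinduction
([cont_op_coind]): it suffices to exhibit a family of operators that is stable
under partial differentiation and gives continuous rapidly decreasing
functions.

Bijectivity comes from [fourier4]: the fourth iterate of [fourier] is
multiplication by a nonzero constant [d], so that [d^-1 F^3] is the inverse of
[F]. By Fubini's theorem
[\int F[phi] psi = \int phi F[psi]] ([fourier_swap]). Replacing [psi] by
[psi (c x)] and letting [c] tend to [0] gives
[psi 0 \int F[phi] = phi 0 \int F[psi]] ([integralRn_fourier]), that is,
[\int F[phi] = c0 phi 0] for a constant [c0]; applied to the translates of
[phi] this says [F[F[phi]] y = c0 phi (- y)]. The constant is not computed: if
it were zero then [\int |F[phi]|^2] would vanish for all [phi], so that [F]
would be zero, and [F[|phi|^2]] at the origin would contradict [phi != 0]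
([exists_fourier_constant]). A nonzero Schwartz function to start from is
provided by the hypothesis that the limit distribution is nonzero. *)

(** * Real and imaginary parts *)

Notation nrm := Normc.normc.

Section ComplexNumbers.
Variable R : realType.
Implicit Types z w : R[i].

Lemma cReD z w : complex.Re (z + w) = complex.Re z + complex.Re w.
Proof. by case: z; case: w. Qed.
Lemma cImD z w : complex.Im (z + w) = complex.Im z + complex.Im w.
Proof. by case: z; case: w. Qed.
Lemma cReM z w : complex.Re (z * w) =
  complex.Re z * complex.Re w - complex.Im z * complex.Im w.
Proof. by case: z; case: w. Qed.
Lemma cImM z w : complex.Im (z * w) =
  complex.Re z * complex.Im w + complex.Im z * complex.Re w.
Proof. by case: z; case: w. Qed.
Lemma cReN z : complex.Re (- z) = - complex.Re z. Proof. by case: z. Qed.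
Lemma cImN z : complex.Im (- z) = - complex.Im z. Proof. by case: z. Qed.

Lemma complex_ext z w :
  complex.Re z = complex.Re w -> complex.Im z = complex.Im w -> z = w.
Proof. by case: z; case: w => /= ? ? ? ? -> ->. Qed.

Lemma nrm_ge0 z : 0 <= nrm z.
Proof. by case: z => a b; rewrite /= sqrtr_ge0. Qed.

Lemma nrm_normr z : `|z| = (nrm z)%:C.
Proof. by rewrite normc_def; case: z. Qed.

Lemma ler_Re_nrm z : `|complex.Re z| <= nrm z.
Proof.
by case: z => a b /=; rewrite -sqrtr_sqr ler_wsqrtr// lerDl sqr_ge0.
Qed.

Lemma ler_Im_nrm z : `|complex.Im z| <= nrm z.
Proof.
by case: z => a b /=; rewrite -sqrtr_sqr ler_wsqrtr// lerDr sqr_ge0.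
Qed.

Lemma ler_nrmD z w : nrm (z + w) <= nrm z + nrm w.
Proof. exact: le_normcD. Qed.

Lemma nrmM z w : nrm (z * w) = nrm z * nrm w.
Proof. exact: Normc.normcM. Qed.

Lemma nrmN z : nrm (- z) = nrm z.
Proof. exact: normcN. Qed.

Lemma nrm_real (x : R) : nrm x%:C = `|x|.
Proof. by rewrite /= expr0n /= addr0 sqrtr_sqr. Qed.

Lemma nrm_i : nrm ('i%C : R[i]) = 1.
Proof. by rewrite /= expr0n /= expr1n add0r sqrtr1. Qed.

Lemma nrm_conj z : nrm (conjc z) = nrm z.
Proof. by case: z => a b /=; rewrite sqrrN. Qed.

Lemma nrm_expi (theta : R) : nrm (expi theta) = 1.
Proof. by rewrite /= cos2Dsin2 sqrtr1. Qed.

Lemma ler_nrm_ReIm z : nrm z <= `|complex.Re z| + `|complex.Im z|.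
Proof.
rewrite {1}[z]complexE (le_trans (ler_nrmD _ _))// nrmM nrm_i mul1r.
by rewrite !nrm_real.
Qed.

(** The modulus lies between the absolute value of either part and the sum of
the two. *)
Lemma cvg_complexP (T : Type) (F : set_system T) (FF : Filter F)
    (u : T -> R[i]) (l : R[i]) :
  (u x : (R[i])^o) @[x --> F] --> (l : (R[i])^o) <->
  (complex.Re (u x) @[x --> F] --> complex.Re l /\
   complex.Im (u x) @[x --> F] --> complex.Im l).
Proof.
split.
  move=> /cvgrPdist_lt ul; split; apply/cvgrPdist_lt => e e0;
    have := ul e%:C; rewrite ltcR => /(_ e0); apply: filterS => x;
    rewrite nrm_normr ltcR; apply: le_lt_trans.
    by rewrite -cReN -cReD ler_Re_nrm.
  by rewrite -cImN -cImD ler_Im_nrm.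
move=> [/cvgrPdist_lt uR /cvgrPdist_lt uI]; apply/cvgrPdist_lt => -[e e'].
rewrite ltcE /= => /andP[/eqP -> e0].
have e20 : 0 < e / 2 by rewrite divr_gt0.
near=> x; rewrite nrm_normr ltcR (le_lt_trans (ler_nrm_ReIm _))//.
rewrite cReD cImD cReN cImN (splitr e) ltrD//; near: x.
  exact: uR.
exact: uI.
Unshelve. all: by end_near. Qed.

End ComplexNumbers.

(** * Partial derivatives of complex-valued functions *)

Section Partial.
Variables (R : realType) (n : nat).
Local Notation Rn := 'rV[R]_n.
Local Notation C := R[i].
Implicit Types (phi psi : Rn -> C) (i : 'I_n).

Lemma continuous_complexP phi :
  continuous (phi : Rn -> C^o) <->
  continuous (fun x => complex.Re (phi x)) /\
  continuous (fun x => complex.Im (phi x)).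
Proof.
split=> [c|[cR cI] x].
  by split=> x; case: ((cvg_complexP _ phi (phi x)).1 (c x)).
by apply/(cvg_complexP (nbhs_filter x)); split; [exact: cR|exact: cI].
Qed.

(** [partial] is total, so an equation [partial i phi = psi] does not say that
[phi] is derivable; this relation does. *)
Definition has_partial i phi psi := forall x,
  is_derive x (delta_mx 0 i) (fun y => complex.Re (phi y)) (complex.Re (psi x)) /\
  is_derive x (delta_mx 0 i) (fun y => complex.Im (phi y)) (complex.Im (psi x)).

Lemma has_partialE i phi psi : has_partial i phi psi -> partial i phi = psi.
Proof.
move=> h; apply/funext => x; have [hR hI] := h x.
by rewrite /partial !derive_val; case: (psi x).
Qed.

Lemma derivable_has_partial i phi :
  (forall x, derivable (fun y => complex.Re (phi y)) x (delta_mx 0 i) /\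
             derivable (fun y => complex.Im (phi y)) x (delta_mx 0 i)) ->
  has_partial i phi (partial i phi).
Proof. by move=> d x; have [? ?] := d x; split; apply: derivableP. Qed.

Lemma has_partial_derivable i phi psi : has_partial i phi psi ->
  forall x, derivable (fun y => complex.Re (phi y)) x (delta_mx 0 i) /\
            derivable (fun y => complex.Im (phi y)) x (delta_mx 0 i).
Proof. by move=> h x; have [? ?] := h x; split; apply: ex_derive. Qed.

Lemma has_partial_cst i (c : C) : has_partial i (fun=> c) (fun=> 0).
Proof. by move=> x; split; exact: is_derive_cst. Qed.

Lemma has_partialD i phi psi dphi dpsi :
  has_partial i phi dphi -> has_partial i psi dpsi ->
  has_partial i (fun x => phi x + psi x) (fun x => dphi x + dpsi x).
Proof.
move=> h1 h2 x; have [R1 I1] := h1 x; have [R2 I2] := h2 x; split.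
  by under eq_fun do rewrite cReD; rewrite cReD; exact: is_deriveD.
by under eq_fun do rewrite cImD; rewrite cImD; exact: is_deriveD.
Qed.

Lemma has_partialM i phi psi dphi dpsi :
  has_partial i phi dphi -> has_partial i psi dpsi ->
  has_partial i (fun x => phi x * psi x)
    (fun x => dphi x * psi x + phi x * dpsi x).
Proof.
move=> h1 h2 x; have [R1 I1] := h1 x; have [R2 I2] := h2 x; split.
  under eq_fun do rewrite cReM.
  apply: (@is_derive_eq _ _ _ _ _ _ _ _
    (is_deriveB (is_deriveM R1 R2) (is_deriveM I1 I2))).
  by rewrite cReD !cReM /GRing.scale/=; ring.
under eq_fun do rewrite cImM.
apply: (@is_derive_eq _ _ _ _ _ _ _ _
  (is_deriveD (is_deriveM R1 I2) (is_deriveM I1 R2))).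
by rewrite cImD !cImM /GRing.scale/=; ring.
Qed.

Lemma has_partial_conj i phi dphi :
  has_partial i phi dphi ->
  has_partial i (fun x => conjc (phi x)) (fun x => conjc (dphi x)).
Proof.
have RJ z : complex.Re (conjc z) = complex.Re z :> R by case: z.
have IJ z : complex.Im (conjc z) = - complex.Im z :> R by case: z.
move=> h x; have [hR hI] := h x; split.
  by under eq_fun do rewrite RJ; rewrite RJ.
by under eq_fun do rewrite IJ; rewrite IJ; exact: is_deriveN.
Qed.

Lemma is_derive_line (f : Rn -> R) (x v : Rn) (d t : R) :
  is_derive (t *: v + x) v f d <->
  is_derive t 1 (fun s : R => f (s *: v + x)) d.
Proof.
suff E : (fun h : R => h^-1 *: ((f \o shift (t *: v + x)) (h *: v) -
         f (t *: v + x))) =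
   (fun h : R => h^-1 *: (((fun s : R => f (s *: v + x)) \o shift t) h%:A -
         f (t *: v + x))).
  by split=> -[d1 d2]; split; move: d1 d2; rewrite /derivable /derive E.
by apply/funext => h /=; rewrite [_%:A]mulr1 scalerDl addrA.
Qed.

Lemma is_derive_affine (f : Rn -> R) (c : R) (h x v : Rn) (d : R) :
  is_derive (c *: x + h) v f d ->
  is_derive x v (fun y => f (c *: y + h)) (c * d).
Proof.
move=> fd; rewrite -[x]add0r -(scale0r v); apply/is_derive_line.
pose g s := f (s *: v + (c *: x + h)).
rewrite (_ : (fun _ => _) = g \o ( *%R c)); last first.
  by apply/funext => s; rewrite /g /= scalerDr scalerA addrA.
have dc : is_derive (0 : R) 1 ( *%R c) c.
  apply: (@is_derive_eq _ _ _ _ _ _ _ _ (is_deriveZ c (is_derive_id _ _))).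
  by rewrite /GRing.scale /= mulr1.
rewrite mulrC.
have dg : is_derive (c * 0) 1 g d.
  by apply/is_derive_line; rewrite mulr0 scale0r add0r.
exact: (@is_derive1_comp _ _ _ _ _ _ dg dc).
Qed.

Lemma has_partial_affine i phi dphi (c : R) (h : Rn) :
  has_partial i phi dphi ->
  has_partial i (fun x => phi (c *: x + h)) (fun x => c%:C * dphi (c *: x + h)).
Proof.
move=> p x; have [pR pI] := p (c *: x + h); split.
  rewrite cReM /= mul0r subr0.
  exact: (@is_derive_affine (fun y => complex.Re (phi y))).
rewrite cImM /= mul0r addr0.
exact: (@is_derive_affine (fun y => complex.Im (phi y))).
Qed.

(** Derivatives of Fourier integrals are obtained from such a remainder bound,
which can be integrated, instead of differentiating under the integral. *)
Lemma is_derive_quadratic (f : Rn -> R) (x v : Rn) (d K : R) :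
  (forall t : R, `|f (t *: v + x) - f x - t * d| <= K * t ^+ 2) ->
  is_derive x v f d.
Proof.
move=> H.
suff cvgd : h^-1 *: ((f \o shift x) (h *: v) - f x) @[h --> 0^'] --> d.
  by apply: DeriveDef; [apply/cvg_ex; exists d|exact: cvg_lim].
have K0 : 0 <= K by have := H 1; rewrite expr1n mulr1; apply: le_trans.
have K1 : 0 < K + 1 by rewrite ltr_wpDl.
apply/cvgrPdist_le => e e0.
have eK : 0 < e / (K + 1) by rewrite divr_gt0.
near=> h.
have h0 : h != 0 by near: h; exact: nbhs_dnbhs_neq.
rewrite /= -normrN opprB.
have -> : h^-1 *: (f (h *: v + x) - f x) - d =
    h^-1 * (f (h *: v + x) - f x - h * d).
  by rewrite /GRing.scale /= [RHS]mulrBr mulKf.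
rewrite normrM normfV ler_pdivrMl ?normr_gt0// (le_trans (H h))//.
rewrite -real_normK ?num_real// expr2 mulrA mulrC ler_wpM2l//.
have -> : e = (K + 1) * (e / (K + 1)) by rewrite mulrC divfK ?gt_eqF.
rewrite ler_pM ?lerDl//=.
by near: h; exact: dnbhs0_le.
Unshelve. all: by end_near. Qed.

End Partial.

(** * Operators on the Schwartz space *)

Section SchwartzOperators.
Variables (R : realType) (n : nat).
Local Notation Rn := 'rV[R]_n.
Local Notation C := R[i].
Local Notation op := ((Rn -> C) -> (Rn -> C)).
Local Notation index := ({ffun 'I_n -> nat} * seq 'I_n)%type.
Implicit Types (phi psi chi m : Rn -> C) (i : 'I_n) (T : op) (l : seq index).

Definition wt (x : Rn) : R := 1 + `|x|.

Lemma wt_ge1 x : 1 <= wt x. Proof. by rewrite lerDl. Qed.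
Lemma wt_gt0 x : 0 < wt x. Proof. exact: lt_le_trans (wt_ge1 x). Qed.
Lemma wt_ge0 x : 0 <= wt x. Proof. exact/ltW/wt_gt0. Qed.
Lemma ler_norm_wt (x : Rn) : `|x| <= wt x. Proof. by rewrite lerDr. Qed.

Lemma ler_coord_norm (x : Rn) j : `|x 0 j| <= `|x|.
Proof. by rewrite [leRHS]mx_normrE; apply: (le_bigmax _ _ (0, j)). Qed.

Lemma ler_coord_wt (x : Rn) j : `|x 0 j| <= wt x.
Proof. exact: le_trans (ler_coord_norm x j) (ler_norm_wt x). Qed.

Lemma ler_monomial_wt a x : `|monomial a x| <= wt x ^+ (\sum_i a i)%N.
Proof.
rewrite /monomial normr_prod -prodrXr ler_prod// => j _.
by rewrite normr_ge0 normrX lerXn2r ?nnegrE ?wt_ge0// ler_coord_wt.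
Qed.

(** The norm is attained at a coordinate, so a power of [wt] is controlled by
finitely many monomials. *)
Lemma ler_wt_coord (x : Rn) N :
  wt x ^+ N <= 2 ^+ N * (1 + \sum_i `|x 0 i| ^+ N).
Proof.
have S0 : 0 <= \sum_i `|x 0 i| ^+ N.
  by apply: sumr_ge0 => j _; rewrite exprn_ge0.
have [x1|x1] := leP `|x| 1.
  rewrite -[leLHS]mulr1 ler_pM ?exprn_ge0 ?wt_ge0//; last by rewrite lerDl.
  by rewrite lerXn2r ?nnegrE ?wt_ge0// -[2]/(1 + 1) lerD2l.
have [|j xj] := @mx_norm_neq0 _ _ _ x.
  by rewrite -[mx_norm x]/(`|x|) gt_eqF// (lt_trans _ x1).
have {}xj : `|x| = `|x 0 j.2|.
  by rewrite -[LHS]/(mx_norm x) xj; case: j {xj} => a b /=; rewrite ord1.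
rewrite (@le_trans _ _ (2 ^+ N * `|x| ^+ N))//.
  rewrite -exprMn lerXn2r ?nnegrE ?wt_ge0 ?mulr_ge0//.
  by rewrite mulr_natl mulr2n lerD2r ltW.
rewrite ler_wpM2l ?exprn_ge0//.
rewrite xj (bigD1 j.2)//= addrCA lerDl addr_ge0//.
by apply: sumr_ge0 => k _; rewrite exprn_ge0.
Qed.

Lemma seminorm_leP a s phi (M : R) :
  (seminorm a s phi <= M%:E)%E <->
  (forall x, `|monomial a x| * nrm (partials s phi x) <= M).
Proof.
split=> [h x|h].
  by rewrite -lee_fin (le_trans _ h)//; apply: ereal_sup_ubound; exists x.
by apply: ge_ereal_sup => _ [x _ <-]; rewrite lee_fin.
Qed.

Lemma partials_rcons s i phi : partials (rcons s i) phi = partials s (partial i phi).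
Proof. by rewrite /partials foldr_rcons. Qed.

Lemma schwartz_continuous phi : schwartz phi -> continuous (phi : Rn -> C^o).
Proof. by move=> [/(_ [::])[]]. Qed.

Lemma smooth_has_partial i phi : smooth phi -> has_partial i phi (partial i phi).
Proof. by move=> sm; apply: derivable_has_partial; case: (sm [::]). Qed.

Lemma schwartz_has_partial i phi :
  schwartz phi -> has_partial i phi (partial i phi).
Proof. by move=> [+ _]; exact: smooth_has_partial. Qed.

Lemma smooth_partial i phi : smooth phi -> smooth (partial i phi).
Proof. by move=> sm s; rewrite -partials_rcons; exact: sm. Qed.

Lemma schwartz_partial i phi : schwartz phi -> schwartz (partial i phi).
Proof.
move=> [sm b]; split; first exact: smooth_partial.
by move=> a s; rewrite /seminorm -partials_rcons; exact: b.
Qed.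

Definition seminorms_le l phi (M : R) :=
  forall p, p \in l -> (seminorm p.1 p.2 phi <= M%:E)%E.

Lemma seminorms_le_cat l1 l2 phi M : seminorms_le (l1 ++ l2) phi M <->
  seminorms_le l1 phi M /\ seminorms_le l2 phi M.
Proof.
split=> [h|[h1 h2] p]; last by rewrite mem_cat => /orP[/h1|/h2].
by split=> p pl; apply: h; rewrite mem_cat pl ?orbT.
Qed.

Lemma schwartz_seminorms_le phi l :
  schwartz phi -> exists M, 0 <= M /\ seminorms_le l phi M.
Proof.
move=> sp; elim: l => [|p l [M [M0 IH]]]; first by exists 0.
have : (seminorm p.1 p.2 phi < +oo)%E by case: sp => _; exact.
case E : (seminorm p.1 p.2 phi) => [r| |]// _.
  exists (Num.max M r); split; first by rewrite le_max M0.
  move=> q; rewrite inE => /orP[/eqP ->|/IH h].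
    by rewrite E lee_fin le_max lexx orbT.
  by rewrite (le_trans h)// lee_fin le_max lexx.
exists M; split => // q; rewrite inE => /orP[/eqP ->|/IH //].
by rewrite E leNye.
Qed.

(** The bounds have to be linear in finitely many seminorms of the argument for
continuity to follow. They do not presuppose that [T chi] is smooth. *)
Definition rapid_op T := forall N, exists l (K : R), 0 <= K /\
  forall chi, schwartz chi -> forall M, 0 <= M -> seminorms_le l chi M ->
    forall x, wt x ^+ N * nrm (T chi x) <= K * M.

(** For linear [T] this is continuity on the Schwartz space. *)
Definition cont_op T := (forall chi, schwartz chi -> schwartz (T chi)) /\
  forall p : index, exists l (K : R), 0 <= K /\
    forall chi, schwartz chi -> forall M, 0 <= M -> seminorms_le l chi M ->
      (seminorm p.1 p.2 (T chi) <= (K * M)%:E)%E.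

Lemma cont_op_seminorms T : cont_op T -> forall ps, exists l (K : R), 0 <= K /\
  forall chi, schwartz chi -> forall M, 0 <= M -> seminorms_le l chi M ->
    seminorms_le ps (T chi) (K * M).
Proof.
move=> [_ cT]; elim=> [|p ps [l [K [K0 IH]]]]; first by exists [::], 0.
have [l' [K' [K'0 h]]] := cT p; exists (l' ++ l), (K' + K).
split=> [|chi schi M M0 /seminorms_le_cat[h1 h2] q]; first exact: addr_ge0.
rewrite inE mulrDl => /orP[/eqP ->|qps].
  by rewrite (le_trans (h _ schi _ M0 h1))// lee_fin lerDl mulr_ge0.
by rewrite (le_trans (IH _ schi _ M0 h2 _ qps))// lee_fin lerDr mulr_ge0.
Qed.

Lemma cont_op_rapid T : cont_op T -> rapid_op T.
Proof.
move=> cT N.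
pose d i : {ffun 'I_n -> nat} := [ffun j => if j == i then N else 0%N].
have d0E x : monomial [ffun=> 0%N] x = 1.
  by rewrite /monomial big1// => j _; rewrite ffunE expr0.
have dE i x : monomial (d i) x = x 0 i ^+ N.
  rewrite /monomial (bigD1 i)//= ffunE eqxx big1 ?mulr1// => j /negPf ji.
  by rewrite ffunE ji expr0.
have [l [K [K0 h]]] := cont_op_seminorms cT
  (([ffun=> 0%N], [::]) :: [seq (d i, [::]) | i <- enum 'I_n]).
exists l, (2 ^+ N * n.+1%:R * K); split=> [|chi schi M M0 hM x].
  by rewrite !mulr_ge0 ?exprn_ge0.
have {}h := h _ schi _ M0 hM.
have h0 : nrm (T chi x) <= K * M.
  have /seminorm_leP/(_ x) := h _ (mem_head _ _).
  by rewrite d0E normr1 mul1r.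
have hi i : `|x 0 i| ^+ N * nrm (T chi x) <= K * M.
  have : (d i, [::]) \in
      ([ffun=> 0%N], [::]) :: [seq (d i, [::] : seq 'I_n) | i <- enum 'I_n].
    by rewrite inE; apply/orP; right; apply/map_f; rewrite mem_enum.
  by move=> /h/seminorm_leP/(_ x); rewrite dE normrX.
rewrite (le_trans (ler_wpM2r (nrm_ge0 _) (ler_wt_coord x N)))//.
rewrite -!mulrA ler_wpM2l ?exprn_ge0// mulrDl mul1r mulr_suml.
rewrite mulr_natl mulrS lerD// (le_trans (ler_sum _ (fun i _ => hi i)))//.
by rewrite sumr_const card_ord.
Qed.

(** A family of operators stable under partial differentiation and whose
members give continuous rapidly decreasing functions acts continuously on the
Schwartz space: iterating the derivatives never leaves the family. *)
Lemma cont_op_coind (K : op -> Prop) :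
  (forall T, K T -> rapid_op T) ->
  (forall T, K T -> forall chi, schwartz chi ->
    continuous (T chi : Rn -> C^o)) ->
  (forall T i, K T -> exists2 T', K T' &
    forall chi, schwartz chi -> has_partial i (T chi) (T' chi)) ->
  forall T, K T -> cont_op T.
Proof.
move=> Kr Kc Kd T KT.
have KS s : exists2 T', K T' &
    forall chi, schwartz chi -> partials s (T chi) = T' chi.
  elim: s => [|i s [T1 KT1 E1]]; first by exists T.
  have [T2 KT2 E2] := Kd _ i KT1; exists T2 => // chi schi.
  by rewrite /= E1// (has_partialE (E2 _ schi)).
have Ks (p : index) : exists l (K : R), 0 <= K /\
    forall chi, schwartz chi -> forall M, 0 <= M -> seminorms_le l chi M ->
      (seminorm p.1 p.2 (T chi) <= (K * M)%:E)%E.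
  have [T1 KT1 E1] := KS p.2.
  have [l [D [D0 h]]] := Kr _ KT1 (\sum_i p.1 i)%N.
  exists l, D; split => // chi schi M M0 hM; apply/seminorm_leP => x.
  rewrite E1// (le_trans _ (h _ schi _ M0 hM x))//.
  by rewrite ler_wpM2r ?nrm_ge0 ?ler_monomial_wt.
split=> // chi schi; split=> [s|a s].
  have [T1 KT1 E1] := KS s; rewrite E1//; split; first exact: Kc.
  move=> i; have [T2 _ h2] := Kd _ i KT1.
  exact: has_partial_derivable (h2 _ schi).
have [l [D [D0 h]]] := Ks (a, s).
have [M [M0 hM]] := schwartz_seminorms_le l schi.
by rewrite (le_lt_trans (h _ schi _ M0 hM))// ltry.
Qed.

Lemma cont_op_id : cont_op id.
Proof.
split=> // p; exists [:: p], 1; split => // chi _ M _ h.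
by rewrite mul1r; apply: h; rewrite mem_head.
Qed.

Lemma cont_op_comp T1 T2 : cont_op T1 -> cont_op T2 -> cont_op (T1 \o T2).
Proof.
move=> c1 c2; split=> [chi schi|p]; first exact/c1.1/c2.1.
have [l [K [K0 h]]] := c1.2 p.
have [l' [K' [K'0 h']]] := cont_op_seminorms c2 l.
exists l', (K * K'); split=> [|chi schi M M0 hM]; first exact: mulr_ge0.
by rewrite -mulrA; apply: h; [exact: c2.1|exact: mulr_ge0|exact: h'].
Qed.

Lemma cont_op_partial i : cont_op (partial i).
Proof.
split=> [chi|p]; first exact: schwartz_partial.
exists [:: (p.1, rcons p.2 i)], 1; split => // chi _ M _ h.
rewrite mul1r /seminorm -partials_rcons.
by apply: (h (p.1, rcons p.2 i)); rewrite mem_head.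
Qed.

Lemma schwartz_rapid phi N : schwartz phi ->
  exists2 M, 0 <= M & forall x, wt x ^+ N * nrm (phi x) <= M.
Proof.
move=> sp; have [l [K [K0 h]]] := cont_op_rapid cont_op_id N.
have [M [M0 hM]] := schwartz_seminorms_le l sp.
by exists (K * M); [exact: mulr_ge0|exact: h].
Qed.

(** The slowly increasing smooth functions. Constants, coordinates, plane waves
and Schwartz functions are all of this kind, so that one closure lemma,
[cont_op_mul], covers all the products below. *)
Definition multiplier m := smooth m /\ forall s, exists N (K : R), 0 <= K /\
  forall x, nrm (partials s m x) <= K * wt x ^+ N.

(** The analogue of [cont_op_coind] for growth instead of decay. *)
Lemma multiplier_coind (P : (Rn -> C) -> Prop) :
  (forall m, P m -> continuous (m : Rn -> C^o)) ->
  (forall m, P m -> exists N (K : R), 0 <= K /\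
    forall x, nrm (m x) <= K * wt x ^+ N) ->
  (forall m i, P m -> exists2 m', P m' & has_partial i m m') ->
  forall m, P m -> multiplier m.
Proof.
move=> Pc Pb Pd m Pm.
have PS s : P (partials s m).
  elim: s => [|i s IH]//=; have [m' Pm' h] := Pd _ i IH.
  by rewrite (has_partialE h).
split=> s; last exact/Pb/PS.
split; first exact/Pc/PS.
move=> i; have [m' _ h] := Pd _ i (PS s); exact: has_partial_derivable h.
Qed.

Lemma multiplier_schwartz phi : schwartz phi -> multiplier phi.
Proof.
apply: multiplier_coind.
- by move=> m /schwartz_continuous.
- move=> m /(schwartz_rapid 0)[M M0 h]; exists 0%N, M; split => // x.
  by rewrite expr0 mulr1; have := h x; rewrite expr0 mul1r.
- move=> m i sm; exists (partial i m); first exact: schwartz_partial.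
  exact: schwartz_has_partial.
Qed.

Lemma continuous_cstC (c : C) : continuous ((fun=> c) : Rn -> C^o).
Proof. exact: cst_continuous. Qed.

Lemma multiplier_cst (c : C) : multiplier (fun=> c).
Proof.
apply: (@multiplier_coind (fun m => exists c, m = fun=> c)); last by exists c.
- by move=> _ [d ->]; exact: continuous_cstC.
- move=> _ [d ->]; exists 0%N, (nrm d); split=> [|x]; first exact: nrm_ge0.
  by rewrite expr0 mulr1.
- move=> _ i [d ->]; exists (fun=> 0); first by exists 0.
  exact: has_partial_cst.
Qed.

Lemma multiplier_partial i m : multiplier m -> multiplier (partial i m).
Proof.
move=> [sm b]; split; first exact: smooth_partial.
by move=> s; rewrite -partials_rcons; exact: b.
Qed.

Lemma is_derive_coord (x v : Rn) j :
  is_derive x v (fun y : Rn => y 0 j) (v 0 j).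
Proof.
apply: (is_derive_quadratic (K := 0)) => t.
by rewrite !mxE addrK subrr normr0 mul0r.
Qed.

Lemma has_partial_coord i j :
  has_partial i (fun x : Rn => (x 0 j)%:C) (fun=> (i == j)%:R).
Proof.
move=> x; have -> : (i == j)%:R = ((i == j)%:R)%:C :> C by case: eqP.
split; last exact: is_derive_cst.
by have := is_derive_coord x (delta_mx 0 i) j; rewrite mxE eqxx /= eq_sym.
Qed.

Lemma continuous_real_complex (u : Rn -> R) :
  continuous u -> continuous ((fun x => (u x)%:C) : Rn -> C^o).
Proof.
by move=> cu; apply/continuous_complexP; split => //; exact: cst_continuous.
Qed.

Lemma multiplier_coord j : multiplier (fun x => (x 0 j)%:C).
Proof.
pose m0 : Rn -> C := fun x => (x 0 j)%:C.
apply: (@multiplier_coind (fun m => multiplier m \/ m = m0)); last by right.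
- move=> m [[sm _]|->]; first by case: (sm [::]).
  by apply: continuous_real_complex; exact: coord_continuous.
- move=> m [[_ b]|->]; first exact: (b [::]).
  exists 1%N, 1; split=> // x.
  by rewrite mul1r expr1 nrm_real; exact: ler_coord_wt.
- move=> m i [mm|->].
    exists (partial i m); first by left; exact: multiplier_partial.
    by apply: smooth_has_partial; case: mm.
  exists (fun=> (i == j)%:R); first by left; exact: multiplier_cst.
  exact: has_partial_coord.
Qed.

(** These operations are put into one family because products alone are not
stable under differentiation: the derivative of a product is a sum of products,
and that of an affine pullback acquires a constant factor. *)
Inductive generated_op : op -> Prop :=
| generated_base T of cont_op T : generated_op T
| generated_add T1 T2 of generated_op T1 & generated_op T2 :
    generated_op (fun chi x => T1 chi x + T2 chi x)
| generated_mul m T of multiplier m & generated_op T :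
    generated_op (fun chi x => m x * T chi x)
| generated_affine (c : R) (h : Rn) T of c != 0 & generated_op T :
    generated_op (fun chi x => T chi (c *: x + h))
| generated_conj T of generated_op T :
    generated_op (fun chi x => conjc (T chi x)).

Lemma ler_wt_affine (c : R) (h x : Rn) : c != 0 ->
  wt x <= (1 + `|c|^-1 * (1 + `|h|)) * wt (c *: x + h).
Proof.
move=> c0; have cx : `|x| <= `|c|^-1 * (`|c *: x + h| + `|h|).
  rewrite ler_pdivlMl ?normr_gt0// -normrZ -[X in `|X| <= _](addrK h).
  exact: ler_normB.
rewrite /wt; set y := `|c *: x + h| in cx *.
have c'0 : 0 <= `|c|^-1 by rewrite invr_ge0.
have y0 : 0 <= y by exact: normr_ge0.
have h0 : 0 <= `|h| by exact: normr_ge0.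
rewrite (@le_trans _ _ (1 + `|c|^-1 * (y + `|h|)))// ?lerD2l//.
have := mulr_ge0 (mulr_ge0 c'0 y0) h0.
nra.
Qed.

Lemma generated_rapid T : generated_op T -> rapid_op T.
Proof.
elim=> {T} [T /cont_op_rapid//|T1 T2 _ IH1 _ IH2 N|
  m T [_ /(_ [::])[Nm [Km [Km0 hm]]]] _ IH N|c h T c0 _ IH N|T _ IH N].
- have [l1 [K1 [K10 h1]]] := IH1 N; have [l2 [K2 [K20 h2]]] := IH2 N.
  exists (l1 ++ l2), (K1 + K2); split; first exact: addr_ge0.
  move=> chi schi M M0 /seminorms_le_cat[b1 b2] x.
  rewrite (le_trans (ler_wpM2l _ (ler_nrmD _ _))) ?exprn_ge0 ?wt_ge0//.
  by rewrite mulrDr mulrDl lerD ?h1 ?h2.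
- have [l [K [K0 hK]]] := IH (N + Nm)%N.
  exists l, (Km * K); split; first exact: mulr_ge0.
  move=> chi schi M M0 b x; rewrite nrmM.
  rewrite (@le_trans _ _ (wt x ^+ N * ((Km * wt x ^+ Nm) * nrm (T chi x))))//.
    by rewrite ler_wpM2l ?exprn_ge0 ?wt_ge0// ler_wpM2r ?nrm_ge0//; exact: hm.
  have -> : wt x ^+ N * (Km * wt x ^+ Nm * nrm (T chi x)) =
      Km * (wt x ^+ (N + Nm) * nrm (T chi x)) by rewrite exprD; ring.
  by rewrite -mulrA ler_wpM2l// hK.
- have [l [K [K0 hK]]] := IH N; set D := (1 + `|c|^-1 * (1 + `|h|)).
  have D0 : 0 <= D by rewrite addr_ge0// mulr_ge0 ?invr_ge0 ?addr_ge0.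
  exists l, (D ^+ N * K); split; first by rewrite mulr_ge0 ?exprn_ge0.
  move=> chi schi M M0 b x.
  rewrite (@le_trans _ _ ((D * wt (c *: x + h)) ^+ N * nrm (T chi (c *: x + h))))//.
    rewrite ler_wpM2r ?nrm_ge0// lerXn2r ?nnegrE ?wt_ge0 ?mulr_ge0 ?wt_ge0//.
    exact: ler_wt_affine.
  by rewrite exprMn -!mulrA ler_wpM2l ?exprn_ge0//; exact: hK.
- have [l [K [K0 hK]]] := IH N; exists l, K; split => // chi schi M M0 b x.
  by rewrite nrm_conj; exact: hK.
Qed.

Lemma generated_continuous T : generated_op T ->
  forall chi, schwartz chi -> continuous (T chi : Rn -> C^o).
Proof.
elim=> {T} [T [cT _] chi /cT/schwartz_continuous//|
  T1 T2 _ IH1 _ IH2 chi schi x|m T [sm _] _ IH chi schi x|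
  c h T c0 _ IH chi schi x|T _ IH chi schi].
- exact: (cvgD (IH1 _ schi x) (IH2 _ schi x)).
- exact: (@cvgM C _ _ _ _ _ _ _ ((sm [::]).1 x) (IH _ schi x)).
- have aff : {for x, continuous (fun y : Rn => c *: y + h)}.
    exact: (cvgD (@scaler_continuous R Rn c x) (cvg_cst h)).
  exact: (continuous_comp aff (IH _ schi (c *: x + h))).
- have /continuous_complexP[cR cI] := IH _ schi.
  apply/continuous_complexP; split.
    rewrite (_ : (fun _ => _) = fun x => complex.Re (T chi x))//.
    by apply/funext => x; case: (T chi x).
  rewrite (_ : (fun _ => _) = fun x => - complex.Im (T chi x)).
    by move=> x; exact: (cvgN (cI x)).
  by apply/funext => x; case: (T chi x).
Qed.

Lemma generated_has_partial T i : generated_op T -> exists2 T', generated_op T' &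
  forall chi, schwartz chi -> has_partial i (T chi) (T' chi).
Proof.
elim=> {T} [T cT|T1 T2 _ [T1' g1 h1] _ [T2' g2 h2]|m T mm gT [T' g h]|
  c y T c0 gT [T' g h]|T gT [T' g h]].
- exists (partial i \o T).
    by apply: generated_base; apply: cont_op_comp => //; exact: cont_op_partial.
  by move=> chi /cT.1; exact: schwartz_has_partial.
- exists (fun chi x => T1' chi x + T2' chi x); first exact: generated_add.
  by move=> chi schi; apply: has_partialD; [exact: h1|exact: h2].
- exists (fun chi x => partial i m x * T chi x + m x * T' chi x).
    by apply: generated_add; apply: generated_mul => //; exact: multiplier_partial.
  move=> chi schi; apply: has_partialM; last exact: h.
  by apply: smooth_has_partial; case: mm.
- exists (fun chi x => c%:C * T' chi (c *: x + y)).
    apply: (@generated_mul (fun=> c%:C) (fun chi x => T' chi (c *: x + y))).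
      exact: multiplier_cst.
    exact: generated_affine.
  by move=> chi schi; apply: has_partial_affine; exact: h.
- exists (fun chi x => conjc (T' chi x)); first exact: generated_conj.
  by move=> chi schi; apply: has_partial_conj; exact: h.
Qed.

Lemma generated_cont_op T : generated_op T -> cont_op T.
Proof.
apply: cont_op_coind; [exact: generated_rapid|exact: generated_continuous|].
by move=> S i; exact: generated_has_partial.
Qed.

Lemma cont_op_mul m : multiplier m -> cont_op (fun chi x => m x * chi x).
Proof.
move=> mm; apply: generated_cont_op.
exact: (generated_mul mm (generated_base cont_op_id)).
Qed.

Lemma cont_op_affine (c : R) (h : Rn) : c != 0 ->
  cont_op (fun chi x => chi (c *: x + h)).
Proof.
move=> c0; apply: generated_cont_op.
exact: (generated_affine h c0 (generated_base cont_op_id)).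
Qed.

Lemma schwartz_mul m phi : multiplier m -> schwartz phi ->
  schwartz (fun x => m x * phi x).
Proof. by move=> /cont_op_mul[+ _]; exact. Qed.

Lemma schwartzZ (c : C) phi : schwartz phi -> schwartz (fun x => c * phi x).
Proof. by apply: schwartz_mul; exact: multiplier_cst. Qed.

Lemma schwartzD phi psi : schwartz phi -> schwartz psi ->
  schwartz (fun x => phi x + psi x).
Proof.
move=> sphi spsi.
have E s : partials s (fun x => phi x + psi x) =
    (fun x => partials s phi x + partials s psi x).
  elim: s => [//|i s IH] /=; rewrite IH; apply: has_partialE.
  by apply: has_partialD; apply: derivable_has_partial;
    [case: (sphi.1 s)|case: (spsi.1 s)].
split=> [s|a s].
  have [c1 d1] := sphi.1 s; have [c2 d2] := spsi.1 s; rewrite E; split.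
    by move=> x; exact: (cvgD (c1 x) (c2 x)).
  move=> i; apply: (has_partial_derivable (psi := fun x =>
    partial i (partials s phi) x + partial i (partials s psi) x)).
  by apply: has_partialD; exact: derivable_has_partial.
have [M1 [M10 h1]] := schwartz_seminorms_le [:: (a, s)] sphi.
have [M2 [M20 h2]] := schwartz_seminorms_le [:: (a, s)] spsi.
apply: (@le_lt_trans _ _ (M1 + M2)%:E); last exact: ltry.
apply/seminorm_leP => x; rewrite E.
rewrite (le_trans (ler_wpM2l _ (ler_nrmD _ _)))// mulrDr lerD//.
  by have /seminorm_leP := h1 _ (mem_head _ _); exact.
by have /seminorm_leP := h2 _ (mem_head _ _); exact.
Qed.

Lemma schwartz_affine (c : R) (h : Rn) phi : c != 0 -> schwartz phi ->
  schwartz (fun x => phi (c *: x + h)).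
Proof. by move=> /(cont_op_affine h)[+ _]; exact. Qed.

Lemma schwartz_conj phi : schwartz phi -> schwartz (fun x => conjc (phi x)).
Proof.
apply: (generated_cont_op (generated_conj (generated_base cont_op_id))).1.
Qed.

End SchwartzOperators.

(** * Lebesgue measure on R^n *)

Section TupleMeasure.
Variables (R : realType).
Local Notation leb := (@lebesgue_measure R).
Local Notation mu := (@lebesgue_measure_tuple R).

Lemma tnth_cons n (x : R) (t : n.-tuple R) (i : 'I_n.+1) :
  tnth (tuple_cons (x, t)) i =
  if unlift ord0 i is Some j then tnth t j else x.
Proof.
case: unliftP => [j ->|->]; first by rewrite /tuple_cons /= tnthS.
by rewrite /tuple_cons /= tnth0.
Qed.

(** Truncating every coordinate to a grid of mesh [1/(k+1)] gives maps with
countably many values that converge to the identity; composing a continuous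
function with them exhibits it as a limit of measurable functions. *)
Lemma measurable_row_of_tuple n (u : 'rV[R]_n -> R) : continuous u ->
  measurable_fun [set: n.-tuple R] (fun t => u (row_of_tuple t)).
Proof.
move=> cu.
pose fl k (t : n.-tuple R) : {ffun 'I_n -> int} :=
  [ffun i => Num.floor (tnth t i * k.+1%:R)].
pose grid k (z : {ffun 'I_n -> int}) : 'rV[R]_n :=
  \row_i ((z i)%:~R / k.+1%:R).
apply: (measurable_fun_cvg (h := fun k t => u (grid k (fl k t)))).
  move=> k _ B mB; rewrite setTI.
  pose cell (z : {ffun 'I_n -> int}) : set (n.-tuple R) :=
    \bigcap_(i in [set: 'I_n]) ((fun t : n.-tuple R => tnth t i) @^-1`
      `[(z i)%:~R / k.+1%:R, ((z i) + 1)%:~R / k.+1%:R[%classic).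
  have cellP z t : cell z t <-> fl k t = z.
    split=> [h|<- i _].
      apply/ffunP => i; rewrite ffunE; apply: floor_def.
      have := h i I; rewrite /= in_itv /= => /andP[].
      by rewrite ler_pdivrMr// ltr_pdivlMr// => -> ->.
    rewrite /= in_itv /= ffunE ler_pdivrMr// ltr_pdivlMr//.
    by rewrite Num.Theory.floor_le_tmp floorD1_gt.
  have mcell z : measurable (cell z).
    apply: fin_bigcap_measurable => // i _.
    rewrite -[X in measurable X]setTI.
    by apply: (@measurable_tnth _ R n i) => //; exact: measurable_itv.
  rewrite (_ : _ @^-1` B =
    \bigcup_z (if u (grid k z) \in B then cell z else set0)).
    apply: countable_bigcupT_measurable => // z.
    by case: ifP.
  apply/seteqP; split=> t /=.
    by move=> Bt; exists (fl k t) => //; rewrite mem_set//; apply/cellP.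
  by move=> [z _]; case: ifP => // /set_mem Bz /cellP ->.
move=> t _.
suff : grid k (fl k t) @[k --> \oo] --> row_of_tuple t.
  by move=> h; apply: (continuous_cvg _ _ h); exact: cu.
apply/cvgrPdist_le => e e0.
near=> k.
rewrite [leLHS]mx_normrE; apply/bigmax_leP; split; first exact: ltW.
move=> [a i] _; rewrite !mxE /= ffunE.
have k0 : 0 < k.+1%:R :> R by [].
rewrite -(@ler_pM2r _ k.+1%:R)// -[X in _ * X <= _](gtr0_norm k0) -normrM.
rewrite mulrBl divfK ?gt_eqF// (@le_trans _ _ 1)//.
  rewrite ger0_norm ?subr_ge0 ?Num.Theory.floor_le_tmp// lerBlDl.
  by have := floorD1_gt (tnth t i * k.+1%:R); rewrite intrD => /ltW.
rewrite -ler_pdivrMl// mulr1 ltW// (lt_le_trans (truncnS_gt _))//.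
rewrite ler_nat ltnS ltnW//.
near: k; exact: nbhs_infty_gt.
Unshelve. all: by end_near. Qed.

Lemma ge0_integral_cons n (f : n.+1.-tuple R -> \bar R) :
  measurable_fun setT f -> (forall t, 0 <= f t)%E ->
  (\int[mu n.+1]_t f t = \int[leb]_x \int[mu n]_t f (tuple_cons (x, t)))%E.
Proof.
move=> mf f0.
have -> : (\int[mu n.+1]_t f t =
    \int[pushforward (leb \x mu n) (@tuple_cons R n)]_t f t)%E by [].
rewrite ge0_integral_pushforward//=; last exact: measurable_tuple_cons.
rewrite preimage_setT.
apply: (fubini_tonelli1 (m1 := leb) (m2 := mu n) (f \o @tuple_cons R n)) => //=.
by apply: measurableT_comp => //; exact: measurable_tuple_cons.
Qed.

Lemma measurable_affine (c h : R) :
  measurable_fun setT (fun x : measurableTypeR R => c * x + h : measurableTypeR R).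
Proof.
by apply: measurable_funD => //; apply: measurable_funM.
Qed.

Lemma lebesgue_measure_affine (c h : R) (A : set R) : 0 < c -> measurable A ->
  leb A = (c%:E *
    pushforward leb (fun x : measurableTypeR R => (c * x + h)%R : measurableTypeR R) A)%E.
Proof.
move=> c0 mA.
pose P : {measure set (measurableTypeR R) -> \bar R} :=
  measure_function_pushforward__canonical__measure_function_Measure
    leb (measurable_affine c h).
apply: (lebesgue_measure_unique (mu := mscale (NngNum (ltW c0)) P)) => // _ [[a b]] _ <-.
rewrite /= /mscale /= /pushforward.
rewrite (_ : _ @^-1` _ = `](a - h) / c, (b - h) / c]%classic); last first.
  apply/seteqP; split=> x /=; rewrite !in_itv /= ltr_pdivrMr// ler_pdivlMr//;
  by rewrite ltrBlDr lerBrDr mulrC.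
rewrite !lebesgue_measure_itv /= !lte_fin ltr_pM2r ?invr_gt0// ltrD2r.
case: ifP => _; last by rewrite mule0.
rewrite -!EFinB -EFinM -mulrBl; congr (_%:E).
by rewrite mulrC divfK ?gt_eqF//; ring.
Qed.

Lemma ge0_integral_affine1 (c h : R) (f : R -> \bar R) : 0 < c ->
  measurable_fun setT f -> (forall x, 0 <= f x)%E ->
  (\int[leb]_x f (c * x + h)%R = (c^-1)%:E * \int[leb]_x f x)%E.
Proof.
move=> c0 mf f0.
pose P : {measure set (measurableTypeR R) -> \bar R} :=
  measure_function_pushforward__canonical__measure_function_Measure
    leb (measurable_affine c h).
have -> : (\int[leb]_x f x = \int[mscale (NngNum (ltW c0)) P]_x f x)%E.
  by apply: eq_measure_integral => A mA _; exact: (lebesgue_measure_affine h).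
rewrite ge0_integral_mscale//.
rewrite (ge0_integral_pushforward (measurable_affine c h) leb)//=.
by rewrite muleA -EFinM mulVf ?gt_eqF// mul1e.
Qed.

Definition affine_tuple n (c : R) (h : 'rV[R]_n) (t : n.-tuple R) : n.-tuple R :=
  [tuple c * tnth t i + h 0 i | i < n].

Lemma row_of_affine_tuple n c h (t : n.-tuple R) :
  row_of_tuple (affine_tuple c h t) = c *: row_of_tuple t + h.
Proof. by apply/rowP => i; rewrite !mxE tnth_mktuple. Qed.

Lemma measurable_affine_tuple n c h : measurable_fun setT (@affine_tuple n c h).
Proof.
apply/measurable_fun_tnthP => i /=.
rewrite (_ : _ \o _ = fun t => c * tnth t i + h 0 i); last first.
  by apply/funext => t /=; rewrite tnth_mktuple.
apply: measurable_funD => //; apply: measurable_funM => //.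
exact: measurable_tnth.
Qed.

Lemma affine_tuple_cons n c (h : 'rV[R]_n.+1) x (t : n.-tuple R) :
  affine_tuple c h (tuple_cons (x, t)) =
  tuple_cons (c * x + h 0 ord0, affine_tuple c (\row_i h 0 (lift ord0 i)) t).
Proof.
apply/eq_from_tnth => i; rewrite tnth_mktuple !tnth_cons.
by case: unliftP => [j ->|->]//; rewrite tnth_mktuple mxE.
Qed.

(** Tonelli's theorem reduces the dimension by one. *)
Lemma ge0_integral_affine n (c : R) h (f : n.-tuple R -> \bar R) : 0 < c ->
  measurable_fun setT f -> (forall t, 0 <= f t)%E ->
  (\int[mu n]_t f (affine_tuple c h t) = (c ^- n)%:E * \int[mu n]_t f t)%E.
Proof.
move=> c0; elim: n h f => [|n IH] h f mf f0.
  rewrite expr0 invr1 mul1e; apply: eq_integral => t _.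
  by congr f; apply/eq_from_tnth => -[].
have mf' : measurable_fun setT (f \o @affine_tuple _ c h).
  by apply: measurableT_comp => //; exact: measurable_affine_tuple.
rewrite (ge0_integral_cons mf')//= [X in (_ = _ * X)%E](ge0_integral_cons mf)//.
pose h' := \row_i h 0 (lift ord0 i).
pose G x := (\int[mu n]_t f (tuple_cons (x, t)))%E.
have mfc : measurable_fun setT (f \o @tuple_cons R n).
  by apply: measurableT_comp => //; exact: measurable_tuple_cons.
have mG : measurable_fun setT G.
  apply: (measurable_fun_fubini_tonelli_F (m2 := mu n) (f \o @tuple_cons R n)) => //.
  by move=> z; exact: f0.
transitivity (\int[leb]_x ((c ^- n)%:E * G (c * x + h 0 ord0)%R))%E.
  apply: eq_integral => x _.
  under eq_integral do rewrite affine_tuple_cons.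
  rewrite (IH h' (fun t => f (tuple_cons (c * x + h 0 ord0, t))))//.
  by apply: (measurableT_comp mfc); exact: measurable_pair1.
rewrite ge0_integralZl//; last 3 first.
- by apply: (measurableT_comp mG); exact: measurable_affine.
- by move=> x _; apply: integral_ge0.
- by rewrite lee_fin invr_ge0 exprn_ge0// ltW.
rewrite (ge0_integral_affine1 _ c0 mG); last by move=> x; exact: integral_ge0.
by rewrite muleA -EFinM exprSr invfM.
Qed.

(** A product of functions of one variable is used as integrable majorant
because its integral factorises. *)
Definition cauchy_weight n (t : n.-tuple R) : R :=
  \prod_i (1 + tnth t i ^+ 2)^-1.

Lemma cauchy_weight_ge0 n (t : n.-tuple R) : 0 <= cauchy_weight t.
Proof. by apply: prodr_ge0 => i _; rewrite invr_ge0 addr_ge0 ?sqr_ge0. Qed.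

Lemma measurable_oneDsqrV : measurable_fun setT (fun x : R => (1 + x ^+ 2)^-1).
Proof. by apply: continuous_measurable_fun; exact: continuous_oneDsqrV. Qed.

Lemma measurable_cauchy_weight n : measurable_fun setT (@cauchy_weight n).
Proof.
apply: measurable_prod => i _.
apply: (measurableT_comp measurable_oneDsqrV).
exact: measurable_tnth.
Qed.

Lemma integral_oneDsqrV_lty :
  (\int[leb]_x ((1 + x ^+ 2)^-1)%:E < +oo)%E.
Proof.
pose g x : \bar R := ((1 + x ^+ 2)^-1)%:E.
have mg : measurable_fun setT g.
  by apply/measurable_EFinP; exact: measurable_oneDsqrV.
have g0 x : (0 <= g x)%E by rewrite lee_fin invr_ge0 addr_ge0 ?sqr_ge0.
have half : (\int[leb]_(x in `[0%R, +oo[) g x < +oo)%E.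
  by have := @integral0y_oneDsqr R; rewrite /oneDsqr /= => ->; rewrite ltry.
have E : [set: R] = `]-oo, 0%R[ `|` `[0%R, +oo[.
  apply/seteqP; split=> // x _ /=; rewrite !in_itv /= andbT.
  by case: (ltP x 0); [left|right].
rewrite E ge0_integral_setU//=; last 3 first.
- by rewrite -E.
- by move=> x _; exact: g0.
- apply/disj_setPS => x [] /=; rewrite !in_itv /= andbT => x0.
  by rewrite leNgt x0.
rewrite lte_add_pinfty//.
apply: le_lt_trans half; rewrite ge0_integration_by_substitution0//.
under [leRHS]eq_integral do rewrite /g sqrrN.
apply: ge0_subset_integral => //=; first exact: measurable_funTS.
  by move=> x _; exact: g0.
by apply: subset_itvl; rewrite bnd_simp.
Qed.

Lemma integral_cauchy_weight_lty n :
  (\int[mu n]_t (cauchy_weight t)%:E < +oo)%E.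
Proof.
elim: n => [|n IH].
  rewrite (eq_integral (cst 1%:E)); last first.
    by move=> t _; rewrite /cauchy_weight big_ord0.
  by rewrite integral_cst// mul1e /= diracT ltry.
rewrite ge0_integral_cons; last 2 first.
- by apply/measurable_EFinP; exact: measurable_cauchy_weight.
- by move=> t; rewrite lee_fin cauchy_weight_ge0.
under eq_integral => x _.
  under eq_integral => t _.
    rewrite /cauchy_weight big_ord_recl tnth_cons unlift_none EFinM.
    under eq_bigr => i _ do rewrite tnth_cons liftK.
    over.
  rewrite ge0_integralZl//; last 3 first.
  - by apply/measurable_EFinP; exact: measurable_cauchy_weight.
  - by move=> t _; rewrite lee_fin cauchy_weight_ge0.
  - by rewrite lee_fin invr_ge0 addr_ge0 ?sqr_ge0.
  over.
rewrite ge0_integralZr//; last 3 first.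
- by apply/measurable_EFinP; exact: measurable_oneDsqrV.
- by move=> x _; rewrite lee_fin invr_ge0 addr_ge0 ?sqr_ge0.
- by apply: integral_ge0 => t _; rewrite lee_fin cauchy_weight_ge0.
rewrite lte_mul_pinfty//.
- by apply: integral_ge0 => x _; rewrite lee_fin invr_ge0 addr_ge0 ?sqr_ge0.
- rewrite ge0_fin_numE; first exact: integral_oneDsqrV_lty.
  by apply: integral_ge0 => x _; rewrite lee_fin invr_ge0 addr_ge0 ?sqr_ge0.
Qed.

End TupleMeasure.

(** * Taylor bounds *)

Section Taylor.
Variable R : realType.

Lemma MVT_between (f g : R -> R) (t : R) :
  (forall s : R, is_derive s 1 f (g s)) ->
  exists2 c, `|c| <= `|t| & f t - f 0 = t * g c.
Proof.
move=> df.
have cf (a b : R) : {within `[a, b], continuous f}.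
  by apply: derivable_within_continuous => s _; exact: ex_derive.
have [t0|t0] := leP 0 t.
  have [c] := MVT_segment t0 (fun s _ => df s) (cf 0 t).
  rewrite in_itv /= subr0 mulrC => /andP[c0 ct] ->; exists c => //.
  by rewrite !ger0_norm.
have [c] := MVT_segment (ltW t0) (fun s _ => df s) (cf t 0).
rewrite in_itv /= => /andP[tc c0] E; exists c.
  by rewrite !ler0_norm ?lerN2// ltW.
by rewrite -[LHS]opprB E sub0r mulrN opprK mulrC.
Qed.

(** The mean value theorem is applied twice, hence the constant [B] and not
[B / 2]. *)
Lemma taylor1 (f g h : R -> R) (t B : R) :
  (forall s : R, is_derive s 1 f (g s)) ->
  (forall s : R, is_derive s 1 g (h s)) ->
  (forall s, `|s| <= `|t| -> `|h s| <= B) ->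
  `|f t - f 0 - t * g 0| <= B * t ^+ 2.
Proof.
move=> df dg hB; have [c ct ->] := MVT_between t df.
have [d dc E] := MVT_between c dg.
rewrite -mulrBr E !normrM -[t ^+ 2]real_normK ?num_real// expr2.
rewrite mulrA [leRHS]mulrC ler_pM ?mulr_ge0// ?ler_wpM2l//.
exact/hB/(le_trans dc).
Qed.

Lemma nrm_expiB (a b : R) : nrm (expi a - expi b) <= 2 * `|a - b|.
Proof.
have dc (s : R) : is_derive s 1 (fun s => cos (s + b)) (- sin (s + b)).
  by apply: is_derive_eq; rewrite /GRing.scale /=; ring.
have ds (s : R) : is_derive s 1 (fun s => sin (s + b)) (cos (s + b)).
  by apply: is_derive_eq; rewrite /GRing.scale /=; ring.
have [c _ Ec] := MVT_between (a - b) dc.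
have [d _ Es] := MVT_between (a - b) ds.
rewrite (le_trans (ler_nrm_ReIm _))// cReD cImD cReN cImN /=.
move: Ec Es; rewrite subrK add0r => -> ->; rewrite !normrM normrN mulr_natl mulr2n.
by rewrite lerD// ler_piMr// ?sin_max ?cos_max.
Qed.

Lemma nrm_expi_taylor (a b : R) :
  nrm (expi (a + b) - expi b - a%:C * ('i%C * expi b)) <= 2 * a ^+ 2.
Proof.
have dc (s : R) : is_derive s 1 (fun s => cos (s + b)) (- sin (s + b)).
  by apply: is_derive_eq; rewrite /GRing.scale /=; ring.
have ds (s : R) : is_derive s 1 (fun s => sin (s + b)) (cos (s + b)).
  by apply: is_derive_eq; rewrite /GRing.scale /=; ring.
have dns (s : R) : is_derive s 1 (fun s => - sin (s + b)) (- cos (s + b)).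
  exact: is_deriveN.
rewrite (le_trans (ler_nrm_ReIm _))// !(cReD, cImD, cReN, cImN, cReM, cImM) /=.
rewrite mulr_natl mulr2n lerD//.
  have := @taylor1 _ _ _ a 1 dc dns; rewrite add0r mul1r => H.
  rewrite (_ : _ - _ - _ = cos (a + b) - cos b - a * - sin b); last by ring.
  by apply: H => s _; rewrite normrN cos_max.
have := @taylor1 _ _ _ a 1 ds dc; rewrite add0r mul1r => H.
rewrite (_ : _ - _ - _ = sin (a + b) - sin b - a * cos b); last by ring.
by apply: H => s _; rewrite normrN sin_max.
Qed.

End Taylor.

(** * Integration of rapidly decreasing functions *)

Section IntegralRn.
Variables (R : realType) (n : nat).
Local Notation Rn := 'rV[R]_n.
Local Notation C := R[i].
Local Notation mu := (lebesgue_measure_tuple R n).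
Implicit Types (phi psi chi : Rn -> C).

Definition cintegrable phi :=
  mu.-integrable setT (EFin \o (fun t => complex.Re (phi (row_of_tuple t)))) /\
  mu.-integrable setT (EFin \o (fun t => complex.Im (phi (row_of_tuple t)))).

Lemma integralRnD phi psi : cintegrable phi -> cintegrable psi ->
  integralRn (fun x => phi x + psi x) = integralRn phi + integralRn psi.
Proof.
move=> [R1 I1] [R2 I2]; apply: complex_ext.
  rewrite cReD /= -RintegralD//.
  by apply: eq_Rintegral => t _; rewrite cReD.
rewrite cImD /= -RintegralD//.
by apply: eq_Rintegral => t _; rewrite cImD.
Qed.

Lemma integrableZ_EFin (r : R) (u : n.-tuple R -> R) :
  mu.-integrable setT (EFin \o u) -> mu.-integrable setT (EFin \o (fun t => r * u t)).
Proof.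
move=> iu; rewrite (_ : _ \o _ = (fun t => r%:E * (EFin \o u) t)%E).
  exact: integrableZl.
by apply/funext => t /=; rewrite EFinM.
Qed.

Lemma integralRnZ (c : C) phi : cintegrable phi ->
  integralRn (fun x => c * phi x) = c * integralRn phi.
Proof.
move=> [iR iI]; apply: complex_ext.
  rewrite cReM /= -!RintegralZl// -RintegralB//; [|exact: integrableZ_EFin..].
  by apply: eq_Rintegral => t _; exact: cReM.
rewrite cImM /= -!RintegralZl// -RintegralD//; [|exact: integrableZ_EFin..].
by apply: eq_Rintegral => t _; exact: cImM.
Qed.

Lemma eq_integralRn phi psi : phi =1 psi -> integralRn phi = integralRn psi.
Proof. by move=> /funext ->. Qed.

Lemma measurable_Re phi : continuous (phi : Rn -> C^o) ->
  measurable_fun setT (fun t : n.-tuple R => complex.Re (phi (row_of_tuple t))).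
Proof.
by move=> /continuous_complexP[cR _]; exact: (measurable_row_of_tuple cR).
Qed.

Lemma measurable_Im phi : continuous (phi : Rn -> C^o) ->
  measurable_fun setT (fun t : n.-tuple R => complex.Im (phi (row_of_tuple t))).
Proof.
by move=> /continuous_complexP[_ cI]; exact: (measurable_row_of_tuple cI).
Qed.

Lemma integrable_cauchy_weight (M : R) :
  mu.-integrable setT (EFin \o (fun t => M * cauchy_weight t)).
Proof.
apply: integrableZ_EFin; apply/integrableP; split.
  by apply/measurable_EFinP; exact: measurable_cauchy_weight.
apply: le_lt_trans (integral_cauchy_weight_lty R n).
rewrite le_eqVlt; apply/orP; left; apply/eqP; apply: eq_integral => t _ /=.
by rewrite ger0_norm// cauchy_weight_ge0.
Qed.

Lemma cauchy_weight_wt (t : n.-tuple R) :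
  1 <= wt (row_of_tuple t) ^+ (2 * n) * cauchy_weight t.
Proof.
rewrite /cauchy_weight exprM -[X in _ ^+ X]card_ord -prodr_const -big_split /=.
apply: (big_ind (fun r => 1 <= r)) => // [|i _]; first exact: mulr_ege1.
rewrite ler_pdivlMr ?mul1r; last by rewrite ltr_wpDr ?sqr_ge0.
have h : tnth t i ^+ 2 <= `|row_of_tuple t| ^+ 2.
  rewrite -real_normK ?num_real// lerXn2r ?nnegrE//.
  by have := ler_coord_norm (row_of_tuple t) i; rewrite mxE.
have h0 : 0 <= `|row_of_tuple t| by [].
by rewrite /wt sqrrD expr1n mul1r -addrA lerD2l (le_trans h)// lerDr mulrn_wge0.
Qed.

(** The factor [2] accounts for the separate estimates of the real and imaginary
parts. *)
Definition cauchy_mass : R := 2 * Rintegral mu setT (@cauchy_weight R n).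

Lemma cauchy_mass_ge0 : 0 <= cauchy_mass.
Proof.
rewrite mulr_ge0//; apply: Rintegral_ge0 => t _; exact: cauchy_weight_ge0.
Qed.

(** The exponent [2 * n] is what [cauchy_weight] requires, since every factor
[1 + x_i^2] is at most [(1 + |x|)^2]. *)
Definition decays (M : R) phi := continuous (phi : Rn -> C^o) /\
  forall x, wt x ^+ (2 * n) * nrm (phi x) <= M.

Lemma decays_nrm M phi : decays M phi -> forall t : n.-tuple R,
  nrm (phi (row_of_tuple t)) <= M * cauchy_weight t.
Proof.
move=> [_ h] t; have w0 := cauchy_weight_ge0 t.
have := ler_wpM2l (nrm_ge0 (phi (row_of_tuple t))) (cauchy_weight_wt t).
rewrite mulr1 => /le_trans; apply.
by rewrite mulrA ler_wpM2r// mulrC h.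
Qed.

Lemma decays_integrable M phi : decays M phi -> cintegrable phi.
Proof.
move=> dec; have h := decays_nrm dec; have [c _] := dec.
split; apply: (le_integrable measurableT _ _ (integrable_cauchy_weight M)).
- by apply/measurable_EFinP; exact: (measurable_Re c).
- move=> t _ /=; rewrite lee_fin (le_trans (ler_Re_nrm _))//.
  by rewrite (le_trans (h t))// ler_norm.
- by apply/measurable_EFinP; exact: (measurable_Im c).
- move=> t _ /=; rewrite lee_fin (le_trans (ler_Im_nrm _))//.
  by rewrite (le_trans (h t))// ler_norm.
Qed.

Lemma nrm_integralRn_le M phi : decays M phi ->
  nrm (integralRn phi) <= M * cauchy_mass.
Proof.
move=> dec; have [iR iI] := decays_integrable dec; have h := decays_nrm dec.
have iw : mu.-integrable setT (EFin \o @cauchy_weight R n).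
  have := integrable_cauchy_weight 1.
  by under [X in _ \o X]eq_fun do rewrite mul1r.
have le1 (u : n.-tuple R -> R) : mu.-integrable setT (EFin \o u) ->
    (forall t, `|u t| <= M * cauchy_weight t) ->
    `|Rintegral mu setT u| <= M * Rintegral mu setT (@cauchy_weight R n).
  move=> iu hu; rewrite (le_trans (le_normr_Rintegral _ _))//.
  rewrite -RintegralZl//; apply: le_Rintegral => //.
    exact: (integrable_norm iu).
  exact: integrable_cauchy_weight.
rewrite (le_trans (ler_nrm_ReIm _))//= /cauchy_mass mulrCA mulr_natl mulr2n.
rewrite lerD//; apply: le1 => // t; apply: le_trans (h t).
  exact: ler_Re_nrm.
exact: ler_Im_nrm.
Qed.

Lemma schwartz_decays phi : schwartz phi -> exists M, decays M phi.
Proof.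
move=> sp; have [M _ h] := schwartz_rapid (2 * n) sp.
by exists M; split => //; exact: schwartz_continuous.
Qed.

Lemma schwartz_integrable phi : schwartz phi -> cintegrable phi.
Proof. by move=> /schwartz_decays[M]; exact: decays_integrable. Qed.

Lemma Rintegral_affine (c : R) (h : Rn) (u : n.-tuple R -> R) : 0 < c ->
  measurable_fun setT u ->
  Rintegral mu setT (fun t => u (affine_tuple c h t)) =
  c ^- n * Rintegral mu setT u.
Proof.
move=> c0 mu_; rewrite /Rintegral.
have cn0 : 0 < c ^- n by rewrite invr_gt0 exprn_gt0.
have mE : measurable_fun setT (EFin \o u) by exact/measurable_EFinP.
rewrite (_ : \int[mu]_t (u (affine_tuple c h t))%:E =
  (c ^- n)%:E * \int[mu]_t (u t)%:E)%E.
  move: (\int[mu]_t (u t)%:E)%E => [r| |] //=.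
    by rewrite gt0_muley ?lte_fin// mulr0.
  by rewrite gt0_muleNy ?lte_fin// mulr0.
rewrite [LHS]integralE [in RHS]integralE.
rewrite (_ : (fun t => (u (affine_tuple c h t))%:E)^\+ =
  (fun t => (EFin \o u)^\+ (affine_tuple c h t)))%E; last
  by apply/funext => t; rewrite ?(funeposE, funenegE).
rewrite (_ : (fun t => (u (affine_tuple c h t))%:E)^\- =
  (fun t => (EFin \o u)^\- (affine_tuple c h t)))%E; last
  by apply/funext => t; rewrite ?(funeposE, funenegE).
rewrite !ge0_integral_affine//; [|exact: measurable_funeneg|exact: measurable_funepos].
set a := integral mu setT (EFin \o u)^\+%E; set b := integral mu setT (EFin \o u)^\-%E.
have a0 : (0 <= a)%E by apply: integral_ge0.
have b0 : (0 <= b)%E by apply: integral_ge0.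
move: a b a0 b0 => [a| |] [b| |]//= _ _.
- by rewrite -!EFinM -EFinB -mulrBr.
- by rewrite !(gt0_muley, gt0_muleNy) ?lte_fin.
- by rewrite !(gt0_muley, gt0_muleNy) ?lte_fin.
- by rewrite !(gt0_muley, gt0_muleNy) ?lte_fin.
Qed.

Lemma integralRn_affine (c : R) (h : Rn) phi : 0 < c ->
  continuous (phi : Rn -> C^o) ->
  integralRn (fun x => phi (c *: x + h)) = (c ^- n)%:C * integralRn phi.
Proof.
move=> c0 cphi; apply: complex_ext.
  rewrite cReM mul0r subr0 -[RHS](Rintegral_affine h c0 (measurable_Re cphi)).
  by apply: eq_Rintegral => t _; rewrite row_of_affine_tuple.
rewrite cImM mul0r addr0 -[RHS](Rintegral_affine h c0 (measurable_Im cphi)).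
by apply: eq_Rintegral => t _; rewrite row_of_affine_tuple.
Qed.

Lemma ler_wt_shift i (s : R) (x : Rn) : `|s| <= 1 ->
  wt x <= 2 * wt (x + s *: delta_mx 0 i).
Proof.
move=> s1; have d1 : `|delta_mx 0 i : Rn| <= 1.
  rewrite [leLHS]mx_normrE; apply/bigmax_leP; split => // -[a b] _ /=.
  by rewrite mxE; case: (_ && _); rewrite ?normr1 ?normr0.
have sd : `|s *: (delta_mx 0 i : Rn)| <= 1.
  by rewrite normrZ -[1]mulr1 ler_pM.
have xs : `|x| <= `|x + s *: delta_mx 0 i| + 1.
  rewrite -[X in `|X| <= _](addrK (s *: delta_mx 0 i)).
  by rewrite (le_trans (ler_normB _ _))// lerD2l.
have y0 : 0 <= `|x + s *: delta_mx 0 i| by [].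
by rewrite /wt; lra.
Qed.

Lemma has_partial_line i phi psi (x : Rn) (s : R) : has_partial i phi psi ->
  is_derive s 1 (fun s : R => complex.Re (phi (s *: delta_mx 0 i + x)))
    (complex.Re (psi (s *: delta_mx 0 i + x))) /\
  is_derive s 1 (fun s : R => complex.Im (phi (s *: delta_mx 0 i + x)))
    (complex.Im (psi (s *: delta_mx 0 i + x))).
Proof.
move=> h; have [hR hI] := h (s *: delta_mx 0 i + x).
by split; [have := (is_derive_line _ _ _ _ _).1 hR|
           have := (is_derive_line _ _ _ _ _).1 hI].
Qed.

(** By translation invariance the integral of [phi (x + t e_i) - phi x]
vanishes; its first-order term in [t] is the integral of the derivative. *)
Lemma integralRn_partial i phi : schwartz phi -> integralRn (partial i phi) = 0.
Proof.
move=> sp; set d1 := partial i phi; set d2 := partial i d1.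
have sd1 : schwartz d1 by exact: schwartz_partial.
have hd1 : has_partial i phi d1 by exact: schwartz_has_partial.
have hd2 : has_partial i d1 d2 by exact: schwartz_has_partial.
have [M M0 hM] := schwartz_rapid (2 * n) (schwartz_partial i sd1).
(* [wt x <= 2 wt (x + s e_i)] for [|s| <= 1] gives the power of [2], and the two
   parts of a complex number the factor [2]. *)
pose K : R := 2 * (2 ^+ (2 * n) * M).
have main (t : R) : 0 < t -> t <= 1 ->
    t * nrm (integralRn d1) <= t ^+ 2 * (K * cauchy_mass).
  move=> t0 t1.
  pose e : Rn := delta_mx 0 i.
  pose chi x := phi (1 *: x + t *: e) + (- 1) * phi x + (- t)%:C * d1 x.
  have st : schwartz (fun x => phi (1 *: x + t *: e)).
    by apply: schwartz_affine => //; exact: oner_neq0.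
  have sm : schwartz (fun x => (- 1) * phi x) by exact: schwartzZ.
  have sl : schwartz (fun x => (- t)%:C * d1 x) by exact: schwartzZ.
  have Echi : integralRn chi = - (t%:C * integralRn d1).
    rewrite integralRnD; [|exact/schwartz_integrable/schwartzD|exact: schwartz_integrable].
    rewrite integralRnD; [|exact: schwartz_integrable..].
    rewrite integralRn_affine//; last exact: schwartz_continuous.
    rewrite !integralRnZ; [|exact: schwartz_integrable..].
    by rewrite expr1n invr1 mul1r mulN1r subrr add0r rmorphN mulNr.
  have dchi : decays (t ^+ 2 * K) chi.
    split; first exact/schwartz_continuous/schwartzD/sl/schwartzD.
    move=> x.
    have bound (s : R) : `|s| <= `|t| ->
        nrm (d2 (s *: e + x)) <= 2 ^+ (2 * n) * M / wt x ^+ (2 * n).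
      rewrite (ger0_norm (ltW t0)) => st'.
      have s1 := le_trans st' t1.
      rewrite ler_pdivlMr ?exprn_gt0 ?wt_gt0//.
      have h1 := hM (s *: e + x).
      rewrite (le_trans _ (ler_wpM2l _ h1)) ?exprn_ge0//.
      rewrite [leRHS]mulrA -exprMn [leRHS]mulrC ler_wpM2l ?nrm_ge0//.
      rewrite lerXn2r ?nnegrE ?mulr_ge0 ?wt_ge0//.
      by rewrite addrC; exact: ler_wt_shift.
    have TR := @taylor1 _ _ _ _ t _ (fun s => (has_partial_line x s hd1).1)
      (fun s => (has_partial_line x s hd2).1)
      (fun s st => le_trans (ler_Re_nrm _) (bound s st)).
    have TI := @taylor1 _ _ _ _ t _ (fun s => (has_partial_line x s hd1).2)
      (fun s => (has_partial_line x s hd2).2)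
      (fun s st => le_trans (ler_Im_nrm _) (bound s st)).
    rewrite -ler_pdivlMl ?exprn_gt0 ?wt_gt0// (le_trans (ler_nrm_ReIm _))//.
    have ER (a b c : C) : complex.Re (a + (- 1) * b + (- t)%:C * c) =
        complex.Re a - complex.Re b - t * complex.Re c.
      by case: a b c => [? ?] [? ?] [? ?] /=; ring.
    have EI (a b c : C) : complex.Im (a + (- 1) * b + (- t)%:C * c) =
        complex.Im a - complex.Im b - t * complex.Im c.
      by case: a b c => [? ?] [? ?] [? ?] /=; ring.
    rewrite /chi ER EI scale1r [x + _]addrC.
    rewrite scale0r add0r in TR TI.
    rewrite (le_trans (lerD TR TI))// /K le_eqVlt; apply/orP; left; apply/eqP.
    by ring.
  have := nrm_integralRn_le dchi; rewrite Echi nrmN nrmM nrm_real (ger0_norm (ltW t0)).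
  by rewrite mulrA.
have K0 : 0 <= K * cauchy_mass.
  by apply: mulr_ge0; [rewrite /K !mulr_ge0 ?exprn_ge0|exact: cauchy_mass_ge0].
apply: Normc.eq0_normc; apply/eqP; rewrite eq_le nrm_ge0 andbT.
apply/ler_addgt0Pl => e e0; rewrite addr0.
pose t := Num.min 1 (e / (K * cauchy_mass + 1)).
have k1 : 0 < K * cauchy_mass + 1 by rewrite ltr_wpDl.
have t0 : 0 < t by rewrite lt_min ltr01 divr_gt0.
have t1 : t <= 1 by rewrite ge_min lexx.
have := main t t0 t1.
rewrite expr2 -mulrA ler_pM2l// => /le_trans; apply.
rewrite (@le_trans _ _ (t * (K * cauchy_mass + 1)))//.
  by rewrite ler_wpM2l ?(ltW t0)// lerDl.
by rewrite -ler_pdivlMr// ge_min lexx orbT.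
Qed.

End IntegralRn.

(** * The Fourier transform acts on the Schwartz space *)

Section Fourier.
Variables (R : realType) (n : nat).
Local Notation Rn := 'rV[R]_n.
Local Notation C := R[i].
Local Notation op := ((Rn -> C) -> (Rn -> C)).
Local Notation index := ({ffun 'I_n -> nat} * seq 'I_n)%type.
Implicit Types (phi psi chi m : Rn -> C) (i : 'I_n) (T : op) (x xi eta : Rn).

Lemma dotpC x xi : dotp x xi = dotp xi x.
Proof. by apply: eq_bigr => i _; rewrite mulrC. Qed.

Lemma dotpDl x y xi : dotp (x + y) xi = dotp x xi + dotp y xi.
Proof. by rewrite -big_split; apply: eq_bigr => i _; rewrite mxE mulrDl. Qed.

Lemma dotpZl (c : R) x xi : dotp (c *: x) xi = c * dotp x xi.
Proof. by rewrite mulr_sumr; apply: eq_bigr => i _; rewrite mxE mulrA. Qed.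

Lemma dotpBl x y xi : dotp (x - y) xi = dotp x xi - dotp y xi.
Proof. by rewrite dotpDl -scaleN1r dotpZl mulN1r. Qed.

Lemma dotpDr x y xi : dotp xi (x + y) = dotp xi x + dotp xi y.
Proof. by rewrite !(dotpC xi) dotpDl. Qed.

Lemma dotpZr (c : R) x xi : dotp xi (c *: x) = c * dotp xi x.
Proof. by rewrite !(dotpC xi) dotpZl. Qed.

Lemma dotp_delta i x : dotp (delta_mx 0 i) x = x 0 i.
Proof.
rewrite /dotp (bigD1 i)//= mxE !eqxx mul1r big1 ?addr0// => j /negPf ji.
by rewrite mxE ji andbF mul0r.
Qed.

Lemma ler_dotp x xi : `|dotp x xi| <= n%:R * `|x| * `|xi|.
Proof.
rewrite (le_trans (ler_norm_sum _ _ _))//.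
rewrite (@le_trans _ _ (\sum_(i < n) `|x| * `|xi|))//.
  by apply: ler_sum => i _; rewrite normrM ler_pM// ler_coord_norm.
by rewrite sumr_const card_ord -mulrA mulr_natl.
Qed.

Lemma continuous_lipschitz phi (K : R) :
  (forall x y, nrm (phi x - phi y) <= K * `|x - y|) ->
  continuous (phi : Rn -> C^o).
Proof.
move=> H x; apply/(@cvgrPdist_le _ C^o _ (nbhs x) (nbhs_filter x)) => -[e e'].
rewrite ltcE /= => /andP[/eqP -> e0].
have K0 : 0 < `|K| + 1 by rewrite ltr_wpDl.
have eK : 0 < e / (`|K| + 1) by rewrite divr_gt0.
have /cvgrPdist_le/(_ _ eK) near_x : id @ nbhs x --> x by exact: cvg_id.
near=> y.
rewrite nrm_normr lecR (le_trans (H _ _))//.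
rewrite (@le_trans _ _ ((`|K| + 1) * `|x - y|))//.
  by rewrite ler_wpM2r// (le_trans (ler_norm K))// lerDl.
by rewrite mulrC -ler_pdivlMr//; near: y.
Unshelve. all: by end_near. Qed.

Lemma has_partial_quadratic i phi dphi (K : Rn -> R) :
  (forall x (t : R), nrm (phi (t *: delta_mx 0 i + x) - phi x - t%:C * dphi x)
    <= K x * t ^+ 2) ->
  has_partial i phi dphi.
Proof.
move=> H x; split; apply: (is_derive_quadratic (K := K x)) => t;
    rewrite (le_trans _ (H x t))//.
  rewrite (le_trans _ (ler_Re_nrm _))// !(cReD, cReN, cReM) /=.
  by rewrite mul0r subr0.
rewrite (le_trans _ (ler_Im_nrm _))// !(cImD, cImN, cImM) /=.
by rewrite mul0r addr0.
Qed.

Lemma continuous_mulC phi psi : continuous (phi : Rn -> C^o) ->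
  continuous (psi : Rn -> C^o) ->
  continuous ((fun x => phi x * psi x) : Rn -> C^o).
Proof. by move=> c1 c2 x; exact: (@cvgM C _ _ _ _ _ _ _ (c1 x) (c2 x)). Qed.

Definition wave xi x : C := expi (dotp xi x).

Lemma nrm_waveB xi eta x :
  nrm (wave xi x - wave eta x) <= 2 * n%:R * `|xi - eta| * `|x|.
Proof.
rewrite (le_trans (nrm_expiB _ _))// -dotpBl -!mulrA ler_wpM2l//.
by rewrite mulrA ler_dotp.
Qed.

Lemma waveC xi x : wave xi x = wave x xi. Proof. by rewrite /wave dotpC. Qed.

Lemma continuous_wave xi : continuous (wave xi : Rn -> C^o).
Proof.
apply: (continuous_lipschitz (K := 2 * n%:R * `|xi|)) => x y.
rewrite !(waveC xi) (le_trans (nrm_waveB _ _ _))// -!mulrA.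
by rewrite [`|xi| * _]mulrC.
Qed.

Lemma has_partial_wave i xi :
  has_partial i (wave xi) (fun x => (xi 0 i)%:C * ('i%C * wave xi x)).
Proof.
apply: (has_partial_quadratic (K := fun=> 2 * xi 0 i ^+ 2)) => x t.
rewrite /wave dotpDr dotpZr dotpC dotp_delta.
rewrite mulrA -rmorphM /= (le_trans (nrm_expi_taylor _ _))//.
by rewrite exprMn mulrA mulrAC.
Qed.

Lemma multiplier_wave xi : multiplier (wave xi).
Proof.
apply: (@multiplier_coind _ _ (fun m => exists c : C, m = fun x => c * wave xi x)).
- move=> _ [c ->].
  exact: (continuous_mulC (@continuous_cstC R n c) (@continuous_wave xi)).
- move=> _ [c ->]; exists 0%N, (nrm c); split=> [|x]; first exact: nrm_ge0.
  by rewrite expr0 mulr1 nrmM nrm_expi mulr1.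
- move=> _ i [c ->]; exists (fun x => (c * (xi 0 i)%:C * 'i%C) * wave xi x).
    by exists (c * (xi 0 i)%:C * 'i%C).
  have -> : (fun x => (c * (xi 0 i)%:C * 'i%C) * wave xi x) =
      (fun x => 0 * wave xi x + c * ((xi 0 i)%:C * ('i%C * wave xi x))).
    by apply/funext => x; rewrite mul0r add0r !mulrA.
  by apply: has_partialM; [exact: has_partial_cst|exact: has_partial_wave].
- by exists 1; apply/funext => x; rewrite mul1r.
Qed.

Lemma schwartz_wave xi chi : schwartz chi ->
  schwartz (fun x => wave xi x * chi x).
Proof. by apply: schwartz_mul; exact: multiplier_wave. Qed.

Lemma decays_mul m chi (A M : R) k : 0 <= A -> schwartz (fun x => m x * chi x) ->
  (forall x, nrm (m x) <= A * wt x ^+ k) ->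
  (forall x, wt x ^+ (2 * n + k) * nrm (chi x) <= M) ->
  decays (A * M) (fun x => m x * chi x).
Proof.
move=> A0 smc hm hM; split=> [|x]; first exact: schwartz_continuous.
rewrite nrmM (@le_trans _ _ (wt x ^+ (2 * n) * (A * wt x ^+ k * nrm (chi x))))//.
  by rewrite ler_wpM2l ?exprn_ge0 ?wt_ge0// ler_wpM2r ?nrm_ge0.
rewrite (le_trans _ (ler_wpM2l A0 (hM x)))// exprD le_eqVlt.
by apply/orP; left; apply/eqP; ring.
Qed.

Lemma fourierD phi psi xi : schwartz phi -> schwartz psi ->
  fourier (fun x => phi x + psi x) xi = fourier phi xi + fourier psi xi.
Proof.
move=> sp1 sp2; rewrite -integralRnD; last 2 first.
- exact/schwartz_integrable/schwartz_wave.
- exact/schwartz_integrable/schwartz_wave.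
by apply: eq_integralRn => x; rewrite mulrDr.
Qed.

Lemma fourierZ (c : C) phi xi : schwartz phi ->
  fourier (fun x => c * phi x) xi = c * fourier phi xi.
Proof.
move=> sp; rewrite -integralRnZ; last exact/schwartz_integrable/schwartz_wave.
by apply: eq_integralRn => x; rewrite mulrCA.
Qed.

Lemma continuous_fourier chi : schwartz chi ->
  continuous (fourier chi : Rn -> C^o).
Proof.
move=> sc; have [M M0 hM] := schwartz_rapid (2 * n + 1) sc.
apply: (continuous_lipschitz (K := 2 * n%:R * M * cauchy_mass R n)) => xi eta.
pose m x := wave xi x + (- 1) * wave eta x.
have -> : fourier chi xi - fourier chi eta = integralRn (fun x => m x * chi x).
  rewrite -mulN1r /fourier -integralRnZ; last exact/schwartz_integrable/schwartz_wave.
  rewrite -integralRnD; last 2 first.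
  - exact/schwartz_integrable/schwartz_wave.
  - exact/schwartz_integrable/schwartzZ/schwartz_wave.
  by apply: eq_integralRn => x; rewrite /m mulrDl mulrA.
have smc : schwartz (fun x => m x * chi x).
  rewrite (_ : (fun _ => _) = (fun x => wave xi x * chi x + (- 1) * (wave eta x * chi x))).
    by apply: schwartzD; [exact: schwartz_wave|exact/schwartzZ/schwartz_wave].
  by apply/funext => x; rewrite /m mulrDl mulrA.
have A0 : 0 <= 2 * n%:R * `|xi - eta| by rewrite !mulr_ge0.
have hm x : nrm (m x) <= 2 * n%:R * `|xi - eta| * wt x ^+ 1.
  rewrite /m mulN1r (le_trans (nrm_waveB _ _ _))// ler_wpM2l//.
  exact: ler_norm_wt.
rewrite (le_trans (nrm_integralRn_le (decays_mul A0 smc hm hM)))// le_eqVlt.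
by apply/orP; left; apply/eqP; ring.
Qed.

(** The Taylor remainder of the wave is at most [2 (t x_i)^2], which costs two
more powers of decay of [chi]. *)
Lemma has_partial_fourier i chi : schwartz chi ->
  has_partial i (fourier chi) (fourier (fun x => (x 0 i)%:C * ('i%C * chi x))).
Proof.
move=> sc; have [M M0 hM] := schwartz_rapid (2 * n + 2) sc.
have sxc : schwartz (fun x => (x 0 i)%:C * ('i%C * chi x)).
  by apply: schwartz_mul; [exact: multiplier_coord|exact: schwartzZ].
apply: (has_partial_quadratic (K := fun=> 2 * M * cauchy_mass R n)) => xi t.
pose zeta := t *: delta_mx 0 i + xi.
pose m x := wave zeta x - wave xi x - (t * x 0 i)%:C * ('i%C * wave xi x).
have sw eta := schwartz_wave eta.
have E : (fun x => m x * chi x) = (fun x => wave zeta x * chi x +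
    (- 1) * (wave xi x * chi x) +
    (- t%:C) * (wave xi x * ((x 0 i)%:C * ('i%C * chi x)))).
  by apply/funext => x; rewrite /m rmorphM /=; ring.
have s1 : schwartz (fun x => wave zeta x * chi x) by exact: sw.
have s2 : schwartz (fun x => (- 1) * (wave xi x * chi x)) by exact/schwartzZ/sw.
have s3 : schwartz (fun x => (- t%:C) * (wave xi x * ((x 0 i)%:C * ('i%C * chi x)))).
  exact/schwartzZ/sw.
have smc : schwartz (fun x => m x * chi x).
  by rewrite E; apply: schwartzD => //; exact: schwartzD.
have -> : fourier chi zeta - fourier chi xi -
    t%:C * fourier (fun x => (x 0 i)%:C * ('i%C * chi x)) xi =
    integralRn (fun x => m x * chi x).
  rewrite E integralRnD; [|exact/schwartz_integrable/schwartzD|exact: schwartz_integrable].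
  rewrite integralRnD; [|exact: schwartz_integrable..].
  rewrite !integralRnZ; [|exact/schwartz_integrable/sw..].
  by rewrite mulN1r mulNr.
have A0 : 0 <= 2 * t ^+ 2 by rewrite mulr_ge0 ?sqr_ge0.
have hm x : nrm (m x) <= 2 * t ^+ 2 * wt x ^+ 2.
  rewrite /m /wave /zeta dotpDl dotpZl dotp_delta (le_trans (nrm_expi_taylor _ _))//.
  rewrite exprMn mulrA ler_wpM2l//.
  by rewrite -real_normK ?num_real// lerXn2r ?nnegrE ?wt_ge0// ler_coord_wt.
rewrite (le_trans (nrm_integralRn_le (decays_mul A0 smc hm hM)))// le_eqVlt.
by apply/orP; left; apply/eqP; ring.
Qed.

(** The integral of the derivative of [wave xi x * chi x] vanishes. *)
Lemma fourier_partial i chi xi : schwartz chi ->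
  (xi 0 i)%:C * fourier chi xi = fourier (fun x => 'i%C * partial i chi x) xi.
Proof.
move=> sc; have sd : schwartz (partial i chi) by exact: schwartz_partial.
have h := has_partialM (has_partial_wave i xi) (schwartz_has_partial i sc).
have := integralRn_partial i (schwartz_wave xi sc).
rewrite (has_partialE h) => H0.
rewrite fourierZ//; apply/eqP; rewrite -subr_eq0; apply/eqP.
rewrite -[RHS](mulr0 (- 'i%C)) -[X in _ = _ * X]H0.
have s1 : schwartz (fun x => (xi 0 i)%:C * ('i%C * (wave xi x * chi x))).
  exact/schwartzZ/schwartzZ/schwartz_wave.
have -> : (fun x => (xi 0 i)%:C * ('i%C * wave xi x) * chi x +
    wave xi x * partial i chi x) =
  (fun x => (xi 0 i)%:C * ('i%C * (wave xi x * chi x)) +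
    wave xi x * partial i chi x).
  by apply/funext => x; rewrite !mulrA.
rewrite integralRnD; [|exact: schwartz_integrable|exact/schwartz_integrable/schwartz_wave].
rewrite integralRnZ; last exact/schwartz_integrable/schwartzZ/schwartz_wave.
rewrite integralRnZ; last exact/schwartz_integrable/schwartz_wave.
rewrite -/(fourier chi xi) -/(fourier (partial i chi) xi).
set X := fourier chi xi; set Y := fourier _ xi; set r := (xi 0 i)%:C.
have -> : - 'i%C * (r * ('i%C * X) + Y) = - ('i%C ^+ 2) * (r * X) - 'i%C * Y by ring.
by rewrite sqr_i opprK mul1r.
Qed.

Lemma fourier_bound T : cont_op T -> exists l (K : R), 0 <= K /\
  forall chi, schwartz chi -> forall M, 0 <= M -> seminorms_le l chi M ->
    forall xi, nrm (fourier (T chi) xi) <= K * M.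
Proof.
move=> cT; have [l [K [K0 h]]] := cont_op_rapid cT (2 * n + 0).
exists l, (K * cauchy_mass R n); split.
  by rewrite mulr_ge0 ?cauchy_mass_ge0.
move=> chi schi M M0 hM xi.
have hm x : nrm (wave xi x) <= 1 * wt x ^+ 0 by rewrite expr0 mulr1 nrm_expi.
have := nrm_integralRn_le (decays_mul ler01 (schwartz_wave xi (cT.1 _ schi)) hm
  (h _ schi _ M0 hM)).
by rewrite mul1r mulrAC.
Qed.

Lemma fourier_monomial_bound T i N : cont_op T -> exists l (K : R), 0 <= K /\
  forall chi, schwartz chi -> forall M, 0 <= M -> seminorms_le l chi M ->
    forall xi, `|xi 0 i| ^+ N * nrm (fourier (T chi) xi) <= K * M.
Proof.
elim: N T => [|N IH] T cT.
  have [l [K [K0 h]]] := fourier_bound cT; exists l, K; split=> // *.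
  by rewrite expr0 mul1r; exact: h.
have [|l [K [K0 h]]] := IH (fun chi x => 'i%C * partial i (T chi) x).
  exact: (cont_op_comp (cont_op_mul (multiplier_cst _ 'i%C))
    (cont_op_comp (cont_op_partial R i) cT)).
exists l, K; split=> // chi schi M M0 hM xi.
rewrite exprSr -mulrA.
have -> : `|xi 0 i| * nrm (fourier (T chi) xi) =
    nrm ((xi 0 i)%:C * fourier (T chi) xi) by rewrite nrmM nrm_real.
by rewrite fourier_partial; [exact: h|exact: cT.1].
Qed.

(** By [ler_wt_coord] only powers of single coordinates are needed, and each
coordinate is traded for a derivative by [fourier_partial]. *)
Lemma rapid_fourier T : cont_op T -> rapid_op (fun chi => fourier (T chi)).
Proof.
move=> cT N; have [l0 [K0 [K00 h0]]] := fourier_bound cT.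
have [l1 [K1 [K10 h1]]] : exists l (K : R), 0 <= K /\
  forall chi, schwartz chi -> forall M, 0 <= M -> seminorms_le l chi M ->
    forall xi i, i \in enum 'I_n ->
      `|xi 0 i| ^+ N * nrm (fourier (T chi) xi) <= K * M.
  elim: (enum 'I_n) => [|j s [l [K [KK h]]]]; first by exists [::], 0.
  have [l' [K' [KK' h']]] := fourier_monomial_bound j N cT.
  exists (l' ++ l), (K' + K); split; first exact: addr_ge0.
  move=> chi schi M M0 /seminorms_le_cat[b' b] xi i; rewrite inE mulrDl.
  move=> /orP[/eqP ->|js].
    by rewrite (le_trans (h' _ schi _ M0 b' xi))// lerDl mulr_ge0.
  by rewrite (le_trans (h _ schi _ M0 b xi _ js))// lerDr mulr_ge0.
exists (l0 ++ l1), (2 ^+ N * (K0 + n%:R * K1)); split.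
  by rewrite mulr_ge0 ?exprn_ge0// addr_ge0// mulr_ge0.
move=> chi schi M M0 /seminorms_le_cat[b0 b1] xi.
rewrite (le_trans (ler_wpM2r (nrm_ge0 _) (ler_wt_coord xi N)))//.
rewrite -!mulrA ler_wpM2l ?exprn_ge0// !mulrDl mul1r mulr_suml.
rewrite lerD ?h0// (le_trans (ler_sum _ (fun i _ =>
  h1 _ schi _ M0 b1 xi i (mem_enum _ _))))//.
by rewrite sumr_const card_ord -mulrA mulr_natl.
Qed.

Lemma cont_op_fourier : cont_op (@fourier R n).
Proof.
apply: (@cont_op_coind _ _ (fun S => exists2 T, cont_op T &
  S = fun chi => fourier (T chi))).
- by move=> _ [T cT ->]; exact: rapid_fourier.
- by move=> _ [T cT ->] chi schi; apply: continuous_fourier; exact: cT.1.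
- move=> _ i [T cT ->].
  exists (fun chi => fourier (fun x => (x 0 i)%:C * ('i%C * T chi x))).
    exists (fun chi x => (x 0 i)%:C * ('i%C * T chi x)) => //.
    exact: (cont_op_comp (cont_op_mul (multiplier_coord R i))
      (cont_op_comp (cont_op_mul (multiplier_cst _ 'i%C)) cT)).
  by move=> chi schi; apply: has_partial_fourier; exact: cT.1.
- by exists id => //; exact: cont_op_id.
Qed.

Lemma schwartz_fourier phi : schwartz phi -> schwartz (fourier phi).
Proof. by move: cont_op_fourier => [+ _]; exact. Qed.

End Fourier.

(** * Fubini's theorem for the Fourier kernel *)

Section Fubini.
Variables (R : realType) (n : nat).
Local Notation Rn := 'rV[R]_n.
Local Notation C := R[i].
Local Notation mu := (lebesgue_measure_tuple R n).
Local Notation w := (@cauchy_weight R n).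

(** The majorant makes [h] integrable for the product measure and every section
of [h] integrable, so that no exceptional null set appears. *)
Lemma Rintegral_swap (h : n.-tuple R * n.-tuple R -> R) (M : R) :
  measurable_fun setT h ->
  (forall s t, `|h (s, t)| <= M * (w s * w t)) ->
  Rintegral mu setT (fun s => Rintegral mu setT (fun t => h (s, t))) =
  Rintegral mu setT (fun t => Rintegral mu setT (fun s => h (s, t))).
Proof.
move=> mh hM.
have ww0 s t : 0 <= w s * w t by rewrite mulr_ge0 ?cauchy_weight_ge0.
have {}hM s t : `|h (s, t)| <= `|M| * (w s * w t).
  by rewrite (le_trans (hM s t))// ler_wpM2r// ler_norm.
have mE : measurable_fun setT (EFin \o h) by exact/measurable_EFinP.
have i1 s : mu.-integrable setT (EFin \o (fun t => h (s, t))).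
  apply: (le_integrable measurableT _ _ (integrable_cauchy_weight n (`|M| * w s))).
    by apply/measurable_EFinP; apply: (measurableT_comp mh); exact: measurable_pair1.
  move=> t _ /=; rewrite lee_fin (le_trans (hM s t))// mulrA ler_norm//.
have i2 t : mu.-integrable setT (EFin \o (fun s => h (s, t))).
  apply: (le_integrable measurableT _ _ (integrable_cauchy_weight n (`|M| * w t))).
    by apply/measurable_EFinP; apply: (measurableT_comp mh); exact: measurable_pair2.
  by move=> s _ /=; rewrite lee_fin (le_trans (hM s t))// mulrCA mulrC ler_norm.
have ih : (mu \x mu)%E.-integrable setT (EFin \o h).
  apply/integrable12ltyP => //.
  have wE (r : R) : 0 <= r -> (\int[mu]_t (r * w t)%:E = r%:E * \int[mu]_t (w t)%:E)%E.
    move=> r0; under eq_integral do rewrite EFinM.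
    rewrite ge0_integralZl//; first by apply/measurable_EFinP; exact: measurable_cauchy_weight.
    by move=> t _; rewrite lee_fin cauchy_weight_ge0.
  have W0 : (0 <= \int[mu]_t (w t)%:E)%E.
    by apply: integral_ge0 => t _; rewrite lee_fin cauchy_weight_ge0.
  have Wfin : (\int[mu]_t (w t)%:E)%E \is a fin_num.
    by rewrite ge0_fin_numE// integral_cauchy_weight_lty.
  apply: (@le_lt_trans _ _ (\int[mu]_s ((`|M| * w s)%:E * \int[mu]_t (w t)%:E))%E).
    apply: ge0_le_integral => //.
    - by move=> s _; exact: integral_ge0.
    - apply: (measurable_fun_fubini_tonelli_F (m2 := mu) (fun z => `|(h z)%:E|%E)) => //.
      exact: measurableT_comp.
    - apply: emeasurable_funM => //.
      by apply/measurable_EFinP/measurable_funM => //; exact: measurable_cauchy_weight.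
    - move=> s _; rewrite -wE ?mulr_ge0 ?cauchy_weight_ge0//.
      apply: ge0_le_integral => //.
      + by apply: measurableT_comp => //; case/integrableP : (i1 s).
      + by apply/measurable_EFinP/measurable_funM => //; exact: measurable_cauchy_weight.
      + by move=> t _; rewrite lee_fin (le_trans (hM s t))// mulrA.
  rewrite -(fineK Wfin).
  under eq_integral => s _ do rewrite -EFinM mulrAC.
  rewrite wE ?mulr_ge0 ?fine_ge0//.
  by rewrite -(fineK Wfin) -EFinM ltry.
have := Fubini ih => /=.
rewrite {1 2}/Rintegral => E.
have -> : (\int[mu]_s (Rintegral mu setT (fun t => h (s, t)))%:E =
    \int[mu]_s \int[mu]_t (h (s, t))%:E)%E.
  by apply: eq_integral => s _; rewrite /Rintegral fineK//; exact: integrable_fin_num (i1 s).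
rewrite E; congr fine.
by apply: eq_integral => t _; rewrite /Rintegral fineK//; exact: integrable_fin_num (i2 t).
Qed.

Definition measurable_complex (H : n.-tuple R * n.-tuple R -> C) :=
  measurable_fun setT (fun z => complex.Re (H z)) /\
  measurable_fun setT (fun z => complex.Im (H z)).

Lemma measurable_complexM H1 H2 : measurable_complex H1 ->
  measurable_complex H2 -> measurable_complex (fun z => H1 z * H2 z).
Proof.
move=> [R1 I1] [R2 I2]; split.
  under eq_fun do rewrite cReM.
  by apply: measurable_funB; exact: measurable_funM.
under eq_fun do rewrite cImM.
by apply: measurable_funD; exact: measurable_funM.
Qed.

Lemma measurable_complex_fst (phi : Rn -> C) : continuous (phi : Rn -> C^o) ->
  measurable_complex (fun z => phi (row_of_tuple z.1)).
Proof.
move=> c; split.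
  exact: (measurableT_comp (measurable_Re c) measurable_fst).
exact: (measurableT_comp (measurable_Im c) measurable_fst).
Qed.

Lemma measurable_complex_snd (phi : Rn -> C) : continuous (phi : Rn -> C^o) ->
  measurable_complex (fun z => phi (row_of_tuple z.2)).
Proof.
move=> c; split.
  exact: (measurableT_comp (measurable_Re c) measurable_snd).
exact: (measurableT_comp (measurable_Im c) measurable_snd).
Qed.

Lemma measurable_complex_wave :
  measurable_complex (fun z => wave (row_of_tuple z.1) (row_of_tuple z.2)).
Proof.
have md : measurable_fun setT (fun z : n.-tuple R * n.-tuple R =>
    dotp (row_of_tuple z.1) (row_of_tuple z.2)).
  apply: measurable_sum => i.
  under eq_fun do rewrite !mxE.
  apply: measurable_funM.
    exact: (measurableT_comp (measurable_tnth i) measurable_fst).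
  exact: (measurableT_comp (measurable_tnth i) measurable_snd).
split=> /=.
  apply: (measurableT_comp _ md).
  by apply: continuous_measurable_fun; exact: continuous_cos.
apply: (measurableT_comp _ md).
by apply: continuous_measurable_fun; exact: continuous_sin.
Qed.

Lemma integralRn_swap (H : Rn -> Rn -> C) (M : R) :
  measurable_complex (fun z => H (row_of_tuple z.1) (row_of_tuple z.2)) ->
  (forall s t, nrm (H (row_of_tuple s) (row_of_tuple t)) <= M * (w s * w t)) ->
  integralRn (fun x => integralRn (H x)) =
  integralRn (fun y => integralRn (H ^~ y)).
Proof.
move=> [mR mI] hM; apply: complex_ext.
  apply: (Rintegral_swap (M := M) mR) => s t.
  by rewrite (le_trans (ler_Re_nrm _)).
apply: (Rintegral_swap (M := M) mI) => s t.
by rewrite (le_trans (ler_Im_nrm _)).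
Qed.

(** Both sides are iterated integrals of [wave xi x * phi x * psi xi]. *)
Lemma fourier_swap (phi psi : Rn -> C) : schwartz phi -> schwartz psi ->
  integralRn (fun x => fourier phi x * psi x) =
  integralRn (fun x => phi x * fourier psi x).
Proof.
move=> sphi spsi.
pose H (xi x : Rn) := wave xi x * phi x * psi xi.
have [M1 d1] := schwartz_decays sphi; have [M2 d2] := schwartz_decays spsi.
transitivity (integralRn (fun xi => integralRn (H xi))).
  apply: eq_integralRn => xi; rewrite mulrC.
  rewrite -integralRnZ; last exact/schwartz_integrable/schwartz_wave.
  by apply: eq_integralRn => x; rewrite mulrC.
rewrite (@integralRn_swap _ (M2 * M1)).
- apply: eq_integralRn => x.
  rewrite -integralRnZ; last exact/schwartz_integrable/schwartz_wave.
  by apply: eq_integralRn => xi; rewrite /H waveC mulrA [_ * phi x]mulrC.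
- apply: measurable_complexM; last exact/measurable_complex_fst/schwartz_continuous.
  apply: measurable_complexM; first exact: measurable_complex_wave.
  exact/measurable_complex_snd/schwartz_continuous.
- move=> s t; rewrite /H !nrmM nrm_expi mul1r mulrC mulrACA.
  by rewrite ler_pM ?nrm_ge0// decays_nrm.
Qed.

End Fubini.

(** * Integrals of nonnegative continuous functions *)

Section Positivity.
Variable R : realType.

Definition box n (a : 'rV[R]_n) (r : R) : set (n.-tuple R) :=
  \bigcap_(i in [set: 'I_n]) ((fun t : n.-tuple R => tnth t i) @^-1`
      `[a 0 i - r, a 0 i + r]%classic).

Lemma measurable_box n a r : measurable (@box n a r).
Proof.
apply: fin_bigcap_measurable => // i _; rewrite -[X in measurable X]setTI.
by apply: (@measurable_tnth _ R n i) => //; exact: measurable_itv.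
Qed.

Lemma box_gt0 n (a : 'rV[R]_n) (r : R) : 0 < r ->
  (0 < lebesgue_measure_tuple R n (box a r))%E.
Proof.
move=> r0; elim: n a => [|n IH] a.
  rewrite (_ : box a r = setT) /= ?diracT//.
  by apply/seteqP; split=> // t _ [].
pose a' : 'rV[R]_n := \row_i a 0 (lift ord0 i).
have -> : lebesgue_measure_tuple R n.+1 (box a r) =
    (@lebesgue_measure R \x lebesgue_measure_tuple R n)%E
      (`[a 0 ord0 - r, a 0 ord0 + r]%classic `*` box a' r).
  transitivity ((@lebesgue_measure R \x lebesgue_measure_tuple R n)%E
    (@tuple_cons R n @^-1` box a r)) => //; congr (_ _).
  apply/seteqP; split=> [[x t] h|[x t] [h1 h2] i _] /=.
    split=> [|i _] /=.
      by have := h ord0 I; rewrite /= tnth_cons unlift_none.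
    by have := h (lift ord0 i) I; rewrite /= tnth_cons liftK mxE.
  rewrite tnth_cons; case: unliftP => [j ->|->]//.
  by have := h2 j I; rewrite /= mxE.
rewrite product_measure1E//; last exact: measurable_box.
rewrite mule_gt0//.
rewrite /= lebesgue_measure_itv /= lte_fin.
have -> : a 0 ord0 - r < a 0 ord0 + r by lra.
by rewrite -EFinB lte_fin; lra.
Qed.

Lemma Rintegral_gt0 n (v : 'rV[R]_n -> R) (a : 'rV[R]_n) :
  continuous v -> (forall x, 0 <= v x) -> 0 < v a ->
  (lebesgue_measure_tuple R n).-integrable setT
    (EFin \o (fun t => v (row_of_tuple t))) ->
  0 < Rintegral (lebesgue_measure_tuple R n) setT (fun t => v (row_of_tuple t)).
Proof.
move=> cv v0 va iv; set mu := lebesgue_measure_tuple R n.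
have [r r0 hr] : exists2 r : R, 0 < r &
    forall x, `|a - x| <= r -> v a / 2 <= v x.
  have va2 : 0 < v a / 2 by rewrite divr_gt0.
  have /cvgrPdist_le/(_ _ va2)/nbhs_ballP[e e0 he] := cv a.
  exists (e / 2); first by rewrite divr_gt0.
  move=> x ax; have /he : ball a e x.
    rewrite -ball_normE /=; apply: (le_lt_trans ax).
    by rewrite ltr_pdivrMr// ltr_pMr// ltr1n.
  by move=> /(le_trans (ler_norm _)) /=; lra.
have mv : measurable_fun setT (fun t : n.-tuple R => v (row_of_tuple t)).
  exact: measurable_row_of_tuple.
apply: fine_gt0; apply/andP; split; last first.
  by rewrite ltey_eq; have := integrable_fin_num measurableT iv => ->.
apply: (@lt_le_trans _ _ (\int[mu]_(t in box a r) (v a / 2)%:E)%E).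
  rewrite integral_cst//=; last exact: measurable_box.
  by rewrite mule_gt0 ?box_gt0// lte_fin divr_gt0.
apply: (@le_trans _ _ (\int[mu]_(t in box a r) (v (row_of_tuple t))%:E)%E).
  apply: ge0_le_integral => //=.
  - exact: measurable_box.
  - by move=> t _; rewrite lee_fin ltW// divr_gt0.
  - by apply/measurable_EFinP; exact: measurable_funTS.
  - move=> t bt; rewrite lee_fin; apply: hr.
    rewrite [leLHS]mx_normrE; apply/bigmax_leP; split; first exact: ltW.
    move=> [b i] _ /=; rewrite !mxE ord1 ler_distlC.
    by have := bt i I; rewrite /= in_itv.
apply: ge0_subset_integral => //=; first exact: measurable_box.
- by apply/measurable_EFinP.
- by move=> t _; rewrite lee_fin.
Qed.

End Positivity.

(** * Inversion *)

Section Inversion.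
Variables (R : realType) (n : nat).
Local Notation Rn := 'rV[R]_n.
Local Notation C := R[i].
Local Notation mu := (lebesgue_measure_tuple R n).
Implicit Types (phi psi chi : Rn -> C) (x y xi : Rn).

Lemma Rintegral_dominated_cvg (f_ : nat -> n.-tuple R -> R)
    (f g : n.-tuple R -> R) :
  (forall k, measurable_fun setT (f_ k)) -> measurable_fun setT f ->
  (forall t, f_ k t @[k --> \oo] --> f t) ->
  mu.-integrable setT (EFin \o g) ->
  (forall k t, `|f_ k t| <= g t) ->
  Rintegral mu setT (f_ k) @[k --> \oo] --> Rintegral mu setT f.
Proof.
move=> mf_ mf ff ig fg.
have m1 k : measurable_fun setT (EFin \o f_ k) by exact/measurable_EFinP.
have m2 : measurable_fun setT (EFin \o f) by exact/measurable_EFinP.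
have a1 : {ae mu, forall t, setT t ->
    ((EFin \o f_ k) t @[k --> \oo] --> (EFin \o f) t)%E}.
  by apply: aeW => t _; apply: cvg_EFin; [exact: nearW|exact: ff].
have a2 : {ae mu, forall t k, setT t -> (`|(EFin \o f_ k) t| <= (EFin \o g) t)%E}.
  by apply: aeW => t k _ /=; rewrite lee_fin.
have [if_ _ cv] := dominated_convergence measurableT m1 m2 a1 ig a2.
apply: fine_cvg; rewrite fineK; last exact: integrable_fin_num if_.
exact: cv.
Qed.

Lemma cvg_integralRn_dilation phi chi : schwartz phi -> schwartz chi ->
  (integralRn (fun x => phi (k.+1%:R^-1 *: x) * chi x) : C^o) @[k --> \oo] -->
  (phi 0%R * integralRn chi : C^o).
Proof.
move=> sphi schi.
have [B B0 hB] := schwartz_rapid 0 sphi.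
have [M dchi] := schwartz_decays schi.
have sk k : schwartz (fun x => phi (k.+1%:R^-1 *: x) * chi x).
  apply: schwartz_mul schi; apply: multiplier_schwartz.
  have k0 : (k.+1%:R^-1 : R) != 0 by rewrite invr_eq0.
  have := schwartz_affine 0 k0 sphi.
  by under [X in schwartz X -> _]eq_fun do rewrite addr0.
have s0 : schwartz (fun x => phi 0 * chi x) by exact: schwartzZ.
rewrite -integralRnZ; last exact: schwartz_integrable.
have cvgx x : (phi (k.+1%:R^-1 *: x) * chi x : C^o) @[k --> \oo] -->
    (phi 0 * chi x : C^o).
  apply: (@cvgM C); last exact: cvg_cst.
  have h0 : (k.+1%:R^-1 : R) *: x @[k --> \oo] --> (0 : Rn).
    rewrite -(scale0r x); apply: cvgZr_tmp; exact: cvg_harmonic.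
  exact: (continuous_cvg _ (schwartz_continuous sphi (x := 0)) h0).
have bnd k (t : n.-tuple R) :
    nrm (phi (k.+1%:R^-1 *: row_of_tuple t) * chi (row_of_tuple t)) <=
    (B * M) * cauchy_weight t.
  rewrite nrmM -mulrA ler_pM ?nrm_ge0//; last exact: decays_nrm.
  by have := hB (k.+1%:R^-1 *: row_of_tuple t); rewrite expr0 mul1r.
apply/cvg_complexP; split.
  apply: (@Rintegral_dominated_cvg
    (fun k t => complex.Re (phi (k.+1%:R^-1 *: row_of_tuple t) * chi (row_of_tuple t)))
    (fun t => complex.Re (phi 0 * chi (row_of_tuple t))) _ _ _ _
    (integrable_cauchy_weight n (B * M))).
  - move=> k; apply: (measurable_Re (schwartz_continuous (sk k))).
  - exact: (measurable_Re (schwartz_continuous s0)).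
  - by move=> t; have /cvg_complexP[] := cvgx (row_of_tuple t).
  - by move=> k t; rewrite (le_trans (ler_Re_nrm _)).
apply: (@Rintegral_dominated_cvg
  (fun k t => complex.Im (phi (k.+1%:R^-1 *: row_of_tuple t) * chi (row_of_tuple t)))
  (fun t => complex.Im (phi 0 * chi (row_of_tuple t))) _ _ _ _
  (integrable_cauchy_weight n (B * M))).
- move=> k; apply: (measurable_Im (schwartz_continuous (sk k))).
- exact: (measurable_Im (schwartz_continuous s0)).
- by move=> t; have /cvg_complexP[] := cvgx (row_of_tuple t).
- by move=> k t; rewrite (le_trans (ler_Im_nrm _)).
Qed.

Lemma schwartz_dilation (c : R) phi : c != 0 -> schwartz phi ->
  schwartz (fun x => phi (c *: x)).
Proof.
move=> c0 /(schwartz_affine 0 c0).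
by under [X in schwartz X -> _]eq_fun do rewrite addr0.
Qed.

Lemma integralRn_dilation (c : R) phi : 0 < c -> continuous (phi : Rn -> C^o) ->
  integralRn (fun x => phi (c *: x)) = (c ^- n)%:C * integralRn phi.
Proof.
move=> c0 cphi; rewrite -(integralRn_affine 0 c0 cphi).
by apply: eq_integralRn => x; rewrite addr0.
Qed.

Lemma integralRn_translation (h : Rn) phi : continuous (phi : Rn -> C^o) ->
  integralRn (fun x => phi (x + h)) = integralRn phi.
Proof.
move=> cphi; have := integralRn_affine h ltr01 cphi.
rewrite expr1n invr1 mul1r => <-.
by apply: eq_integralRn => x; rewrite scale1r.
Qed.

Lemma fourier_dilation (c : R) phi xi : 0 < c -> schwartz phi ->
  fourier (fun x => phi (c *: x)) xi = (c ^- n)%:C * fourier phi (c^-1 *: xi).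
Proof.
move=> c0 sphi.
rewrite -(integralRn_dilation c0); last exact/schwartz_continuous/schwartz_wave.
apply: eq_integralRn => x; congr (expi _ * _).
by rewrite dotpZl dotpZr mulrA mulVf ?mul1r// gt_eqF.
Qed.

Lemma fourier_translation y phi xi : schwartz phi ->
  fourier (fun x => phi (x - y)) xi = wave y xi * fourier phi xi.
Proof.
move=> sphi; rewrite -integralRnZ; last exact/schwartz_integrable/schwartz_wave.
rewrite -(integralRn_translation (- y)); last first.
  exact/schwartz_continuous/schwartzZ/schwartz_wave.
apply: eq_integralRn => x; rewrite mulrA; congr (_ * _).
rewrite /wave [dotp y xi]dotpC.
have -> : dotp xi x = dotp xi (x - y) + dotp xi y by rewrite -dotpDr subrK.
move: (dotp xi (x - y)) (dotp xi y) => a b.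
by apply: complex_ext; rewrite /= ?cosD ?sinD; ring.
Qed.

(** The identity [fourier_swap] with [psi] dilated; the substitution [y |-> c y]
moves the dilation from [fourier psi] back to [phi]. *)
Lemma fourier_dilation_swap (c : R) phi psi : 0 < c -> schwartz phi ->
  schwartz psi ->
  integralRn (fun xi => psi (c *: xi) * fourier phi xi) =
  integralRn (fun y => phi (c *: y) * fourier psi y).
Proof.
move=> c0 sphi spsi; have c'0 : c != 0 by rewrite gt_eqF.
transitivity (integralRn (fun x => fourier phi x * psi (c *: x))).
  by apply: eq_integralRn => x; rewrite mulrC.
rewrite (fourier_swap sphi (schwartz_dilation c'0 spsi)).
pose g x := phi (c *: x) * fourier psi x.
have sg : schwartz g.
  apply: schwartz_mul; last exact: schwartz_fourier.
  exact/multiplier_schwartz/schwartz_dilation.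
have ci0 : 0 < c^-1 by rewrite invr_gt0.
transitivity (integralRn (fun x => (c ^- n)%:C * g (c^-1 *: x))).
  apply: eq_integralRn => x; rewrite fourier_dilation// /g scalerA divff//.
  by rewrite scale1r mulrCA.
rewrite integralRnZ; last first.
  by apply/schwartz_integrable/(schwartz_dilation _ sg); rewrite gt_eqF.
rewrite integralRn_dilation//; last exact: schwartz_continuous.
rewrite mulrA -rmorphM /= exprVn invrK mulVf ?expf_neq0// mul1r//.
Qed.

(** The limit of [fourier_dilation_swap] as [c] tends to [0]. With [psi] fixed it
is the inversion formula at the origin, with an unspecified constant. *)
Lemma integralRn_fourier phi psi : schwartz phi -> schwartz psi ->
  psi 0 * integralRn (fourier phi) = phi 0 * integralRn (fourier psi).
Proof.
move=> sphi spsi.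
have h1 := cvg_integralRn_dilation spsi (schwartz_fourier sphi).
have h2 := cvg_integralRn_dilation sphi (schwartz_fourier spsi).
apply: (cvg_unique (@norm_hausdorff _ C^o) h1).
have -> : (fun k => integralRn (fun x => psi (k.+1%:R^-1 *: x) * fourier phi x)) =
  (fun k => integralRn (fun x => phi (k.+1%:R^-1 *: x) * fourier psi x)).
  by apply/funext => k; apply: fourier_dilation_swap.
exact: h2.
Qed.

Lemma integralRn_conj phi : cintegrable phi ->
  integralRn (fun x => conjc (phi x)) = conjc (integralRn phi).
Proof.
have RJ z : complex.Re (conjc z) = complex.Re z :> R by case: z.
have IJ z : complex.Im (conjc z) = - complex.Im z :> R by case: z.
move=> [_ iI]; apply: complex_ext.
  by rewrite RJ; apply: eq_Rintegral => t _; rewrite RJ.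
rewrite IJ -[RHS]mulN1r -[RHS](RintegralZl _ measurableT iI).
by apply: eq_Rintegral => t _; rewrite IJ mulN1r.
Qed.

Lemma fourier_conj phi xi : schwartz phi ->
  fourier (fun x => conjc (phi x)) xi = conjc (fourier phi (- xi)).
Proof.
move=> sphi; rewrite -integralRn_conj; last exact/schwartz_integrable/schwartz_wave.
apply: eq_integralRn => x; rewrite rmorphM /=; congr (_ * _).
by rewrite /wave -scaleN1r dotpZl mulN1r /expi /= cosN sinN opprK.
Qed.

Lemma integralRn_sqr_neq0 phi x : schwartz phi -> phi x != 0 ->
  integralRn (fun x => conjc (phi x) * phi x) != 0.
Proof.
move=> sphi phix0.
pose v y := complex.Re (conjc (phi y) * phi y).
have vE y : v y = complex.Re (phi y) ^+ 2 + complex.Im (phi y) ^+ 2.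
  by rewrite /v; case: (phi y) => a b /=; ring.
have ss : schwartz (fun x => conjc (phi x) * phi x).
  exact: schwartz_mul (multiplier_schwartz (schwartz_conj sphi)) sphi.
have v0 : 0 < complex.Re (integralRn (fun x => conjc (phi x) * phi x)).
  apply: (@Rintegral_gt0 _ _ v x).
  - by have /continuous_complexP[] := schwartz_continuous ss.
  - by move=> y; rewrite vE addr_ge0 ?sqr_ge0.
  - rewrite vE lt_def addr_ge0 ?sqr_ge0// andbT paddr_eq0 ?sqr_ge0// !sqrf_eq0.
    apply: contra phix0 => /andP[/eqP a0 /eqP b0].
    by apply/eqP/complex_ext.
  - exact: (schwartz_integrable ss).1.
by apply: contraTneq v0 => ->; rewrite ltxx.
Qed.

(** [wave y xi * fourier phi xi] is the transform of a translate of [phi], whose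
value at the origin is [phi (- y)]. *)
Lemma fourier_fourier (c : C) :
  (forall phi, schwartz phi -> integralRn (fourier phi) = c * phi 0) ->
  forall phi y, schwartz phi -> fourier (fourier phi) y = c * phi (- y).
Proof.
move=> H phi y sphi.
transitivity (integralRn (fourier (fun x => phi (x - y)))).
  by apply: eq_integralRn => xi; rewrite fourier_translation.
rewrite H ?sub0r//.
have := schwartz_affine (- y) (oner_neq0 _) sphi.
by under [X in schwartz X -> _]eq_fun do rewrite scale1r.
Qed.

(** The constant is nonzero: otherwise [fourier \o fourier] vanishes on the
Schwartz space, so that [\int |fourier phi|^2 = 0] for every [phi], hence
[fourier] itself vanishes; but [fourier (|gamma|^2) 0 = \int |gamma|^2]. *)
Lemma exists_fourier_constant gamma x : schwartz gamma -> gamma x != 0 ->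
  exists2 c : C, c != 0 &
    forall phi, schwartz phi -> integralRn (fourier phi) = c * phi 0.
Proof.
move=> sg gx0.
pose delta y := gamma (1 *: y + x).
have sd : schwartz delta by apply: schwartz_affine => //; exact: oner_neq0.
have d0 : delta 0 != 0 by rewrite /delta scaler0 add0r.
pose c := integralRn (fourier delta) / delta 0.
have H phi : schwartz phi -> integralRn (fourier phi) = c * phi 0.
  move=> sphi; have := integralRn_fourier sphi sd.
  by move=> /(canRL (mulKf d0)) ->; rewrite /c; ring.
exists c => //; apply/eqP => c0.
have FF phi y : schwartz phi -> fourier (fourier phi) y = 0.
  by move=> sphi; rewrite (fourier_fourier H)// c0 mul0r.
have F0 phi xi : schwartz phi -> fourier phi xi = 0.
  move=> sphi; apply/eqP; have sF := schwartz_fourier sphi.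
  apply: contraTT isT => /(integralRn_sqr_neq0 sF)/negP[].
  apply/eqP; transitivity (integralRn (fun x => fourier phi x * conjc (fourier phi x))).
    by apply: eq_integralRn => y; rewrite mulrC.
  rewrite fourier_swap//; last exact: schwartz_conj.
  rewrite (@eq_integralRn _ _ _ (fun x => 0 * phi x)).
    by rewrite integralRnZ ?mul0r//; exact: schwartz_integrable.
  by move=> y; rewrite fourier_conj// FF// conjc0 mulr0 mul0r.
have ss : schwartz (fun x => conjc (gamma x) * gamma x).
  exact: schwartz_mul (multiplier_schwartz (schwartz_conj sg)) sg.
have /eqP := integralRn_sqr_neq0 sg gx0; apply.
rewrite -[RHS](F0 _ 0 ss); apply: eq_integralRn => y.
rewrite /dotp big1 => [|i _]; last by rewrite mxE mul0r.
by rewrite /expi cos0 sin0 mul1r.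
Qed.

(** Two reflections cancel; stated for the fourth iterate, inversion involves
[fourier] only. *)
Lemma fourier4 gamma x : schwartz gamma -> gamma x != 0 ->
  exists2 d : C, d != 0 & forall phi, schwartz phi ->
    fourier (fourier (fourier (fourier phi))) = (fun x => d * phi x).
Proof.
move=> sg gx0; have [c c0 H] := exists_fourier_constant sg gx0.
exists (c * c); first by rewrite mulf_neq0.
move=> phi sphi; apply/funext => y.
by rewrite !(fourier_fourier H) ?opprK ?mulrA//; exact/schwartz_fourier/schwartz_fourier.
Qed.

End Inversion.

(** * Tempered functionals *)

Section Tempered.
Variables (R : realType) (n : nat).
Local Notation Rn := 'rV[R]_n.
Local Notation C := R[i].
Implicit Types (phi psi : Rn -> C) (f g : functional R n).

Lemma linear_on_schwartz0 f phi : linear_on_schwartz f -> schwartz phi ->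
  f (fun=> 0) = 0.
Proof.
move=> lf sphi; have s0 : schwartz ((fun=> 0) : Rn -> C).
  have := schwartzZ 0 sphi.
  by under [X in schwartz X -> _]eq_fun do rewrite mul0r.
have := lf 1 _ _ s0 s0; under [X in f X = _]eq_fun do rewrite mulr0 addr0.
by rewrite mul1r => /eqP; rewrite addrC -subr_eq subrr => /eqP.
Qed.

Lemma linear_on_schwartzZ f (c : C) phi : linear_on_schwartz f ->
  schwartz phi -> f (fun x => c * phi x) = c * f phi.
Proof.
move=> lf sphi; have f0 := linear_on_schwartz0 lf sphi.
have s0 : schwartz ((fun=> 0) : Rn -> C).
  have := schwartzZ 0 sphi.
  by under [X in schwartz X -> _]eq_fun do rewrite mul0r.
have := lf c _ _ sphi s0; under [X in f X = _]eq_fun do rewrite addr0.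
by rewrite f0 addr0.
Qed.

Lemma linear_neq0 f phi : linear_on_schwartz f -> schwartz phi ->
  f phi != 0 -> exists x, phi x != 0.
Proof.
move=> lf sphi; apply: contraNP => h; apply/eqP.
rewrite -(linear_on_schwartz0 lf sphi); congr f; apply/funext => x.
by apply/eqP; apply: contra_notT h => phix; exists x.
Qed.

Definition linear_op (T : (Rn -> C) -> (Rn -> C)) :=
  forall (c : C) phi psi, schwartz phi -> schwartz psi ->
    T (fun x => c * phi x + psi x) = (fun x => c * T phi x + T psi x).

Lemma linear_op_fourier : linear_op (@fourier R n).
Proof.
move=> c phi psi sphi spsi; apply/funext => xi.
by rewrite fourierD ?fourierZ//; exact: schwartzZ.
Qed.

Lemma linear_op_comp T1 T2 : linear_op T1 -> linear_op T2 -> cont_op T2 ->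
  linear_op (T1 \o T2).
Proof.
move=> l1 l2 [s2 _] c phi psi sphi spsi /=.
by rewrite l2// l1//; exact: s2.
Qed.

Lemma tempered_comp T f (k : C) : linear_op T -> cont_op T -> tempered f ->
  tempered (fun phi => k * f (T phi)).
Proof.
move=> lT cT [lf cf]; split=> [c phi psi sphi spsi|phi sphi e e0].
  by rewrite lT// lf; [ring|exact: cT.1|exact: cT.1].
have k0 : 0 < nrm k + 1 by rewrite ltr_wpDl// nrm_ge0.
have [l [d [d0 h]]] := cf _ (cT.1 _ sphi) _ (divr_gt0 e0 k0).
have [l' [K [K0 hK]]] := cont_op_seminorms cT l.
have K1 : 0 < K + 1 by rewrite ltr_wpDl.
exists l', (d / (K + 1)); split; first by rewrite divr_gt0.
move=> psi spsi hpsi.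
have sD : schwartz (fun x => psi x - phi x).
  have := schwartzD spsi (schwartzZ (- 1) sphi).
  by under [X in schwartz X -> _]eq_fun do rewrite mulN1r.
have TD : T (fun x => psi x - phi x) = (fun x => T psi x - T phi x).
  rewrite (_ : (fun x => psi x - phi x) = (fun x => (- 1) * phi x + psi x)).
    by rewrite lT//; apply/funext => x; rewrite mulN1r addrC.
  by apply/funext => x; rewrite mulN1r addrC.
have hf : nrm (f (T psi) - f (T phi)) < e / (nrm k + 1).
  apply: h; first exact: cT.1.
  move=> p pl; rewrite -TD.
  apply: (@le_lt_trans _ _ (K * (d / (K + 1)))%:E).
    apply: hK => //; first by rewrite divr_ge0// ltW.
    by move=> q ql; exact/ltW/hpsi.
  by rewrite lte_fin mulrCA gtr_pMr// ltr_pdivrMr// mul1r ltrDl.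
rewrite -mulrBr nrmM; move: hf; rewrite ltr_pdivlMr// => /(le_lt_trans _); apply.
by rewrite mulrC ler_wpM2l ?nrm_ge0// lerDl.
Qed.

(** The power [t ^+ n] absorbs the Jacobian in
[fourier (phi (t x)) xi = t^-n fourier phi (xi / t)]. *)
Lemma dilate_distr_fourier (t r : R) f phi : 0 < t ->
  linear_on_schwartz f -> schwartz phi ->
  ((t ^+ n * r)^-1)%:C * dilate t^-1 (distr_fourier f) phi =
  (r^-1)%:C * dilate t f (fourier phi).
Proof.
move=> t0 lf sphi; rewrite /dilate /distr_fourier invrK.
have -> : fourier (fun x => phi (t *: x)) =
    (fun xi => (t ^- n)%:C * fourier phi (t^-1 *: xi)).
  by apply/funext => xi; rewrite fourier_dilation.
rewrite linear_on_schwartzZ//; last first.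
  by apply/schwartz_dilation/schwartz_fourier => //; rewrite invr_eq0 gt_eqF.
rewrite !mulrA -!rmorphM /=; congr (_%:C * _).
by rewrite invfM exprVn invrK -mulrA divff ?mulr1 ?expf_neq0 ?gt_eqF// mulrC.
Qed.

Lemma automodel_power (alpha : R) (rho : R -> R) : automodel alpha rho ->
  automodel (alpha + n%:R) (fun t => t ^+ n * rho t).
Proof.
move=> [r0 rc rl]; split.
- by move=> t t0; rewrite mulr_gt0 ?exprn_gt0 ?r0.
- move=> t t0; exact: (cvgM (@exprn_continuous _ n t) (rc t t0)).
- move=> a a0.
  have -> : a `^ (alpha + n%:R) = a ^+ n * a `^ alpha.
    rewrite powRD; last by rewrite (gt_eqF a0) implybT.
    by rewrite powR_mulrn ?(ltW a0)// mulrC.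
  apply: cvg_trans (cvgM (cvg_cst (a ^+ n)) (rl a a0)).
  apply: near_eq_cvg; near=> t.
  have t0 : 0 < t by near: t; exact: nbhs_pinfty_gt.
  have tn : t ^+ n != 0 by rewrite expf_neq0 ?gt_eqF.
  have rt : rho t != 0 by rewrite gt_eqF ?r0.
  by rewrite /= exprMn; field; rewrite tn rt.
Unshelve. all: by end_near. Qed.

End Tempered.

(** * Fourier transform of quasi-asymptotics *)

(** [T] is the Fourier transform for one implication and its inverse for the
other. *)
Lemma weak_cvg_pullback (R : realType) n (u v : R -> functional R n)
    (g h : functional R n) (T : ('rV[R]_n -> R[i]) -> ('rV[R]_n -> R[i])) :
  (forall phi, schwartz phi -> schwartz (T phi)) ->
  (forall t phi, 0 < t -> schwartz phi -> v t phi = u t (T phi)) ->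
  (forall phi, schwartz phi -> h phi = g (T phi)) ->
  weak_cvg u g -> weak_cvg v h.
Proof.
move=> sT E gh ug phi sphi; rewrite gh//.
apply: cvg_trans (ug _ (sT _ sphi)); apply: near_eq_cvg; near=> t.
by rewrite E.
Unshelve. all: by end_near. Qed.

Theorem theorem3p1 (R : realType) (n : nat) (f : functional R n)
    (alpha : R) (rho : R -> R)
    (hf : tempered f) (hrho : automodel alpha rho) :
  (exists g : functional R n, quasi_asymptotics_infty alpha rho f g) <->
  (exists g : functional R n,
     quasi_asymptotics_zero (- alpha - n%:R) (fun t => t ^+ n * rho t)
       (distr_fourier f) g).
Proof.
have lF := @linear_op_fourier R n; have cF := @cont_op_fourier R n.
have sF := @schwartz_fourier R n.
have tF (g : functional R n) : tempered g -> tempered (distr_fourier g).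
  move=> tg; have := tempered_comp 1 lF cF tg.
  by under [X in tempered X -> _]eq_fun do rewrite mul1r.
split=> -[g [_ _ tg [phi0 [sphi0 /eqP g0]] cv]].
  have [x phi0x] := linear_neq0 tg.1 sphi0 g0.
  have [d d0 F4] := fourier4 sphi0 phi0x.
  exists (distr_fourier g); split.
  - by rewrite -opprD opprK; exact: automodel_power.
  - exact: tF.
  - exact: tF.
  - exists (fourier (fourier (fourier phi0))); split; first exact/sF/sF/sF.
    rewrite /distr_fourier F4// (linear_on_schwartzZ _ tg.1)//.
    by apply/eqP; rewrite mulf_neq0.
  - apply: weak_cvg_pullback cv; first exact: sF.
      by move=> t phi t0 sphi; rewrite dilate_distr_fourier//; case: hf.
    by [].
have [x phi0x] := linear_neq0 tg.1 sphi0 g0.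
have [d d0 F4] := fourier4 sphi0 phi0x.
pose F3 := @fourier R n \o (@fourier R n \o @fourier R n).
have lF3 : linear_op F3.
  exact: linear_op_comp lF (linear_op_comp lF lF cF) (cont_op_comp cF cF).
have cF3 : cont_op F3 by exact: cont_op_comp cF (cont_op_comp cF cF).
have sF3 phi : schwartz phi -> schwartz (F3 phi) by move=> ?; exact/sF/sF/sF.
(* The inverse of [fourier], whose fourth iterate multiplies by [d]. *)
pose Finv phi x := d^-1 * F3 phi x.
have sFinv phi : schwartz phi -> schwartz (Finv phi).
  by move=> sphi; apply: schwartzZ; exact: sF3.
have FinvK phi : schwartz phi -> fourier (Finv phi) = phi.
  move=> sphi; apply/funext => y; rewrite fourierZ; last exact: sF3.
  by rewrite -[fourier (F3 phi)]/(fourier (fourier (fourier (fourier phi)))) F4// mulKf.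
have gE phi : schwartz phi -> d^-1 * g (F3 phi) = g (Finv phi).
  by move=> sphi; rewrite (linear_on_schwartzZ _ tg.1)//; exact: sF3.
exists (fun phi => d^-1 * g (F3 phi)); split; [exact: hrho|exact: hf|..].
- exact: tempered_comp lF3 cF3 tg.
- exists (fourier phi0); split; first exact: sF.
  rewrite -[F3 (fourier phi0)]/(fourier (fourier (fourier (fourier phi0)))) F4//.
  by rewrite (linear_on_schwartzZ _ tg.1)// mulKf//; exact/eqP.
- apply: weak_cvg_pullback cv; first exact: sFinv.
    move=> t phi t0 sphi; rewrite dilate_distr_fourier//; [|by case: hf|exact: sFinv].
    by rewrite FinvK.
  exact: gE.
Qed.
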